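(* Let $m\ge n\ge1$, $\mathfrak g=\mathfrak{osp}(2n|2m)$ with the data below, and let $\Lambda\in\hat{\mathfrak h}^*$ have level $k\ne0$ and satisfy $(\Lambda|\beta_i)=0$ for $i=1,\dots,n$. Then $L(\Lambda)$ is integrable if and only if $\Lambda=k\Lambda_0+\sum_{i=1}^nk_i\beta_i+\sum_{i=n+1}^mk_i\epsilon_i+c\delta$ for some $c\in\mathbb{C}$ and integers $k_i$ with $k\in\mathbb{Z}_{>0}$, $k_i\in\mathbb{Z}_{\ge0}$ ($i=1,\dots,m$), and $k\ge k_m\ge k_{m-1}\ge\dots\ge k_1$.
   Context: Affine setting: $\mathfrak g$ is a basic Lie superalgebra with nondegenerate invariant supersymmetric form $(\cdot|\cdot)$ and Cartan subalgebra $\mathfrak h\subset\mathfrak g_{\bar0}$, identified with $\mathfrak h^*$. $\hat{\mathfrak g}=\mathfrak g[t,t^{-1}]\oplus\mathbb{C}K\oplus\mathbb{C}d$ with $[at^r,bt^s]=[a,b]t^{r+s}+r\delta_{r,-s}(a|b)K$, $K$ central, $[d,at^r]=rat^r$; $\hat{\mathfrak h}=\mathfrak h\oplus\mathbb{C}K\oplus\mathbb{C}d$ with form extended by $(\mathfrak h|\mathbb{C}K+\mathbb{C}d)=0$, $(K|K)=(d|d)=0$, $(K|d)=1$; $\delta,\Lambda_0$ correspond to $K,d$. Given simple roots $\Pi$ of $\mathfrak g$ with highest root $\theta$, the positive roots of $\hat{\mathfrak g}$ are the positive roots of $\mathfrak g$ and all $\alpha+r\delta$, $\alpha$ a root or $0$,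 $r>0$; simple roots $\{\alpha_0=\delta-\theta\}\cup\Pi$. $L(\Lambda)$ is the irreducible highest weight module of highest weight $\Lambda$, level $\Lambda(K)$. $L(\Lambda)$ is $\gamma$-integrable if $\hat{\mathfrak g}_{-\gamma}$ acts locally nilpotently; it is integrable if $\gamma$-integrable for all positive $\gamma\in\Delta^\#_{\bar0}$ and all $\alpha+r\delta$ with $\alpha\in\Delta^\#_{\bar0}$, $r\in\mathbb{Z}_{>0}$, where $\Delta^\#_{\bar0}$ is the root set of the distinguished subalgebra $\mathfrak g^\#_{\bar0}$. Data: $\mathfrak h^*$ has orthogonal basis $\epsilon_1,\dots,\epsilon_m,\delta_1,\dots,\delta_n$ with $(\epsilon_i|\epsilon_i)=\frac12$, $(\delta_i|\delta_i)=-\frac12$. Even roots: $\epsilon_i-\epsilon_j,\pm(\epsilon_i+\epsilon_j),\pm2\epsilon_i$ ($i\ne j\le m$), $\delta_i-\delta_j,\pm(\delta_i+\delta_j)$ ($i\ne j\le n$); odd roots $\pm(\epsilon_i\pm\delta_j)$. $\mathfrak g^\#_{\bar0}=\mathfrak{sp}(2m)$ (roots in the $\epsilon$'s). Simple roots: $\alpha_i=\epsilon_{m-i+1}-\epsilon_{m-i}$ ($1\le i\le m-n$), then $\epsilon_n-\delta_n,\ \delta_n-\epsilon_{n-1},\ \epsilon_{n-1}-\delta_{n-1},\dots,\ \delta_2-\epsilon_1,\ \epsilon_1-\delta_1,\ \epsilon_1+\delta_1$; $\theta=2\epsilon_m$. $\beta_i=\epsilon_i-\delta_i$, $i=1,\dots,n$.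 *)

(* Defs.v *)
From HB Require Import structures.
From mathcomp Require Import all_boot all_algebra.
From mathcomp Require Import Rstruct complex.

Set Implicit Arguments.
Unset Strict Implicit.
Unset Printing Implicit Defensive.

Import GRing.Theory Num.Theory.
Local Open Scope ring_scope.

Definition C : numClosedFieldType := complex Rdefinitions.R.

Section OSP.
Variables m n : nat.

(* The superspace C^{2n|2m}: indices 'I_(n+n+(m+m)); the first 2n are even,
   the last 2m are odd. *)
Definition NN := (n + n + (m + m))%N.
Definition par (x : 'I_NN) : bool := (n + n <= x)%N.

(* Invariant even supersymmetric form B(u,w) = u^T J w:
   symmetric on the even part (pairs j <-> n+j),
   skew on the odd part (J = [[0, I_m], [-I_m, 0]]). *)
Definition Jform : 'M[C]_NN :=
  \matrix_(x, y)
    if ~~ par x && ~~ par y then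
      (((x + n == y :> nat) || (y + n == x :> nat))%N)%:R
    else if par x && par y then
      (((y - (n + n) == x - (n + n) + m)%N)%:R
       - ((x - (n + n) == y - (n + n) + m)%N)%:R)
    else 0.

Definition homog (b : bool) (X : 'M[C]_NN) : Prop :=
  forall x y, (par x (+) par y) != b -> X x y = 0.

(* homogeneous element of parity b of osp: B(Xu,w) + (-1)^{|X||u|} B(u,Xw) = 0 *)
Definition osp_h (b : bool) (X : 'M[C]_NN) : Prop :=
  homog b X /\
  forall x y, (X^T *m Jform) x y + (-1) ^+ (b && par x) * (Jform *m X) x y = 0.

Definition osp (X : 'M[C]_NN) : Prop :=
  exists X0 X1, X = X0 + X1 /\ osp_h false X0 /\ osp_h true X1.

Definition gform (X Y : 'M[C]_NN) : C :=
  \sum_(x < NN) (if par x then 1 else -1) * (X *m Y) x x.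

Definition cartan (H : 'M[C]_NN) : Prop := is_diag_mx H /\ osp H.

Definition evidx (j : 'I_n) : 'I_NN := lshift (m + m) (lshift n j).
Definition oddidx (i : 'I_m) : 'I_NN := rshift (n + n) (lshift m i).

(* h^*: row vectors of length m+n, coordinates (eps_0..eps_{m-1}, delta_0..delta_{n-1})
   (0-based: eps i here is the paper's epsilon_{i+1}, del j is delta_{j+1}). *)
Definition eps (i : nat) : 'rV[C]_(m + n) :=
  \row_(z < m + n) ((z == i :> nat) && (i < m))%N%:R.
Definition del (j : nat) : 'rV[C]_(m + n) :=
  \row_(z < m + n) ((z == m + j :> nat) && (j < n))%N%:R.
Definition beta (i : nat) : 'rV[C]_(m + n) := eps i - del i.

Definition wt_eval (mu : 'rV[C]_(m + n)) (H : 'M[C]_NN) : C :=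
  \sum_(i < m) mu 0 (lshift n i) * H (oddidx i) (oddidx i)
  + \sum_(j < n) mu 0 (rshift m j) * H (evidx j) (evidx j).

(* the induced form on h^*: (eps_i|eps_i) = 1/2, (delta_j|delta_j) = -1/2 *)
Definition hform (mu nu : 'rV[C]_(m + n)) : C :=
  2^-1 * (\sum_(i < m) mu 0 (lshift n i) * nu 0 (lshift n i)
          - \sum_(j < n) mu 0 (rshift m j) * nu 0 (rshift m j)).

Definition rootsp (alpha : 'rV[C]_(m + n)) (X : 'M[C]_NN) : Prop :=
  osp X /\ forall H, cartan H -> H *m X - X *m H = wt_eval alpha H *: X.

(* nonnegative integral combinations of the simple roots
   eps_{j+1}-eps_j (n-1 <= j < m-1), eps_j - delta_j (j < n),
   delta_{j+1} - eps_j (j < n-1), eps_0 + delta_0   (0-based indices) *)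
Definition poscomb (alpha : 'rV[C]_(m + n)) : Prop :=
  exists (a b c : nat -> nat) (d : nat),
    alpha = \sum_(n.-1 <= j < m.-1) (a j)%:R *: (eps j.+1 - eps j)
          + \sum_(j < n) (b j)%:R *: (eps j - del j)
          + \sum_(j < n.-1) (c j)%:R *: (del j.+1 - eps j)
          + d%:R *: (eps 0 + del 0).

(* roots of the distinguished even subalgebra sp(2m) *)
Definition D0sharp (alpha : 'rV[C]_(m + n)) : Prop :=
  (exists i j, [/\ (i < m)%N, (j < m)%N, i != j &
     [\/ alpha = eps i - eps j, alpha = eps i + eps j
       | alpha = - (eps i + eps j)]])
  \/ (exists i, (i < m)%N /\ (alpha = 2%:R *: eps i \/ alpha = - (2%:R *: eps i))).

(* weights of the affine Cartan: afin + alev Lambda_0 + adelta delta *)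
Record affwt := AffWt { afin : 'rV[C]_(m + n); alev : C; adelta : C }.

Section Module.
Variable V : lmodType C.
(* representation of hat g = g[t,t^-1] + CK + Cd on V:
   act r X = action of X t^r, actK = action of K, actd = action of d *)
Variables (act : int -> 'M[C]_NN -> V -> V) (actK actd : V -> V).

Definition is_hat_g_module : Prop :=
  (forall r X a u w, act r X (a *: u + w) = a *: act r X u + act r X w)
  /\ (forall a u w, actK (a *: u + w) = a *: actK u + actK w)
  /\ (forall a u w, actd (a *: u + w) = a *: actd u + actd w)
  /\ (forall r a X Y u, osp X -> osp Y ->
          act r (a *: X + Y) u = a *: act r X u + act r Y u)
  /\ (forall r s b1 b2 X Y u, osp_h b1 X -> osp_h b2 Y ->
          act r X (act s Y u) - (-1) ^+ (b1 && b2) *: act s Y (act r X u)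
          = act (r + s) (X *m Y - (-1) ^+ (b1 && b2) *: (Y *m X)) u
            + (if r + s == 0 then r%:~R * gform X Y else 0) *: actK u)
  /\ (forall r X u, osp X -> actK (act r X u) = act r X (actK u))
  /\ (forall r X u, osp X -> actd (act r X u) - act r X (actd u) = r%:~R *: act r X u)
  /\ (forall u, actK (actd u) = actd (actK u)).

Definition submodule (W : V -> Prop) : Prop :=
  [/\ W 0, (forall a u w, W u -> W w -> W (a *: u + w)),
      (forall r X u, osp X -> W u -> W (act r X u)),
      (forall u, W u -> W (actK u)) & (forall u, W u -> W (actd u))].

Definition irreducible : Prop :=
  forall W, submodule W -> (exists u, W u /\ u != 0) -> forall u, W u.

Definition hw_vector (Lam : affwt) (v : V) : Prop :=
  v != 0
  /\ (forall H, cartan H -> act 0 H v = wt_eval (afin Lam) H *: v)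
  /\ actK v = alev Lam *: v
  /\ actd v = adelta Lam *: v
  /\ (forall (r : nat) X, (0 < r)%N -> osp X -> act r%:Z X v = 0)
  /\ (forall alpha X, poscomb alpha -> alpha != 0 -> rootsp alpha X -> act 0 X v = 0).

Definition is_L (Lam : affwt) : Prop :=
  [/\ is_hat_g_module, irreducible & exists v, hw_vector Lam v].

(* hat g_{-(alpha + r delta)} = g_{-alpha} t^{-r} acts locally nilpotently *)
Definition loc_nilp (alpha : 'rV[C]_(m + n)) (r : nat) : Prop :=
  forall X, rootsp (- alpha) X -> forall u, exists N, iter N (act (- r%:Z) X) u = 0.

Definition integrable : Prop :=
  (forall gamma, D0sharp gamma -> poscomb gamma -> loc_nilp gamma 0)
  /\ (forall alpha (r : nat), D0sharp alpha -> (0 < r)%N -> loc_nilp alpha r).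

End Module.
End OSP.

(* Main.v *)
(* Write k_i for the coordinate of Lambda along eps_i, so that (Lambda|beta_i) = 0
   makes -k_i its coordinate along del_i.
   Necessity is sl(2)-theory on the highest weight vector v for the simple roots
   2 eps_1, eps_(i+1) - eps_i and delta - 2 eps_m of the affine sp(2m).
   Sufficiency: as (Lambda|beta_i) = 0, the vectors f_(beta_i) v vanish, so v is
   also a highest weight vector for the Borel subalgebras obtained by the odd
   reflections in the beta_i; each simple root of the affine sp(2m) is simple for
   one of them, so v is killed by a power of its lowering operator f, since
   otherwise f^(j+1) v would generate a proper submodule.  Hence f is locally
   nilpotent and the set of weights is stable under the simple reflections, thus
   under the reflections in all real roots gamma of the affine sp(2m).  A vector
   f_gamma^N u that never vanishes would give weights mu - N gamma, whose images
   under the reflection in gamma have unbounded degree.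
   Borel subalgebras enter only as gradings: the degree of a root is psi x - psi y
   plus a multiple M of its delta-coefficient, psi being an integer grading of the
   index set, and [highest] means that everything of positive degree kills v. *)

Require Import Defs.
From HB Require Import structures.
From mathcomp Require Import all_boot all_order all_algebra.
From mathcomp Require Import Rstruct complex.
From mathcomp Require Import zify ring.
Import Order.TTheory GRing.Theory Num.Theory.
Local Open Scope ring_scope.

Set Implicit Arguments.
Unset Strict Implicit.
Unset Printing Implicit Defensive.

(** * The matrices of osp(2n|2m) *)

(** The module is an arbitrary irreducible [V] with a highest weight vector: no Verma module and no
    weight decomposition is given. What replaces them is [gen_all]: [V] is spanned from [w] by
    operators chosen so that all others kill [w]. With every operator chosen this yields the weight
    decomposition; with the operators of degree at most 0 it bounds all degrees by that of [w], and
    every contradiction below is a violation of this bound. The odd reflections are needed because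
    two kinds of even roots decompose: eps_(i+1) - eps_i = beta_(i+1) + (delta_(i+1) - eps_i) for i
    < n, and 2 eps_1 = beta_1 + (eps_1 + delta_1). Once beta_(i+1), respectively beta_1, has become
    negative, they are simple. A simple root is then studied with two gradings: one in which it has
    positive degree, and a degenerate one in which it has degree 0 and no other positive root is
    lost. *)

Section Index.
Variables m n : nat.
Local Notation N := (NN m n).
Implicit Types (x y z : 'I_N) (X Y : 'M[C]_N).

Lemma index_bound x : (x < n + n + (m + m))%N.
Proof. exact: ltn_ord. Qed.

Definition dual_nat (x : nat) : nat :=
  if (x < n)%N then (x + n)%N else if (x < n + n)%N then (x - n)%N
  else if (x < n + n + m)%N then (x + m)%N else (x - m)%N.

Lemma dual_subproof x : (dual_nat x < N)%N.
Proof. suff: (dual_nat x < n + n + (m + m))%N by [].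
move: (index_bound x); rewrite /dual_nat.
by do ?[case: ifP => ?]; lia. Qed.

Definition dual x : 'I_N := Ordinal (dual_subproof x).

Lemma dualK : involutive dual.
Proof.
move=> x; apply/val_inj; have := index_bound x; rewrite /= /dual_nat.
case: (ltnP x n) => ?; first by (do ?[case: ifP => ?]; lia).
case: (ltnP x (n + n)) => ?; first by (do ?[case: ifP => ?]; lia).
by case: (ltnP x (n + n + m)) => ?; do ?[case: ifP => ?]; lia.
Qed.

Lemma dual_eq x y : (dual x == dual y) = (x == y).
Proof. by rewrite (inj_eq (inv_inj dualK)). Qed.

Lemma dual_eqC x y : (x == dual y) = (dual x == y).
Proof. by rewrite -dual_eq dualK. Qed.

Lemma par_dual x : par (dual x) = par x.
Proof.
by move: (index_bound x); rewrite /par /= /dual_nat; do ?[case: ifP => ?]; lia.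
Qed.

Lemma dual_neq x : (dual x == x) = false.
Proof.
apply/negbTE; rewrite -val_eqE /= /dual_nat; move: (index_bound x).
by do ?[case: ifP => ?]; lia.
Qed.

(* [Jform] pairs [x] with [dual x] only, with entry [sgnJ x]. *)
Definition sgnJ x : C := if (n + n + m <= x)%N then -1 else 1.

Lemma sgnJ_sq x : sgnJ x * sgnJ x = 1.
Proof. by rewrite /sgnJ; case: ifP; rewrite ?mulrNN mulr1. Qed.

(** The form is symmetric on the even part and skew on the odd part. *)
Lemma sgnJ_dual x : sgnJ (dual x) = (-1) ^+ par x * sgnJ x.
Proof.
have xN := index_bound x.
rewrite /sgnJ /par /= /dual_nat.
case: (ltnP x n) => h1.
  have -> : (n + n + m <= x + n)%N = false by lia.
  have -> : (n + n <= x)%N = false by lia.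
  have -> : (n + n + m <= x)%N = false by lia.
  by rewrite expr0 mul1r.
case: (ltnP x (n + n)) => h2.
  have -> : (n + n + m <= x - n)%N = false by lia.
  have -> : (n + n + m <= x)%N = false by lia.
  by rewrite expr0 mul1r.
rewrite expr1; case: (ltnP x (n + n + m)) => h3.
  have -> : (n + n + m <= x + m)%N = true by lia.
  by rewrite mulr1.
have -> : (n + n + m <= x - m)%N = false by lia.
by rewrite mulrNN mulr1.
Qed.

Lemma JformE x y : Jform m n x y = sgnJ x * (y == dual x)%:R.
Proof.
have xN := index_bound x; have yN := index_bound y.
rewrite !mxE /sgnJ /par -val_eqE /= /dual_nat -!ltnNge.
case: (ltnP x (n + n)) => hx /=.
  have -> : (n + n + m <= x)%N = false by lia.
  rewrite mul1r; case: (ltnP y (n + n)) => hy /=.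
    by congr (nat_of_bool _)%:R; case: ifP => ?; lia.
  by case: ifP => h; rewrite (_ : (_ == _) = false) ?mulr0 //; lia.
case: (ltnP y (n + n)) => hy /=.
  have -> : (x < n)%N = false by lia.
  rewrite (_ : (nat_of_ord y == _) = false) ?mulr0 //; by case: ifP => ?; lia.
have -> : (x < n)%N = false by lia.
case: (leqP (n + n + m) x) => hx2.
  rewrite (_ : (y - (n + n) == x - (n + n) + m)%N = false); last by lia.
  rewrite (_ : (x - (n + n) == y - (n + n) + m)%N = (y == x - m :> nat)%N); last by lia.
  by rewrite sub0r mulN1r.
rewrite (_ : (y - (n + n) == x - (n + n) + m)%N = (y == x + m :> nat)%N); last by lia.
rewrite (_ : (x - (n + n) == y - (n + n) + m)%N = false); last by lia.
by rewrite subr0 mul1r.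
Qed.

Lemma par_evidx (j : 'I_n) : par (evidx m j) = false.
Proof. by rewrite /par /=; have := ltn_ord j; lia. Qed.

Lemma par_oddidx (i : 'I_m) : par (oddidx n i) = true.
Proof. by rewrite /par /=; lia. Qed.

(** The four families carry the weights [del j], [- del j], [eps i], [- eps i]. *)
Lemma index_ind (P : 'I_N -> Prop) :
  (forall j : 'I_n, P (evidx m j)) -> (forall j : 'I_n, P (dual (evidx m j))) ->
  (forall i : 'I_m, P (oddidx n i)) -> (forall i : 'I_m, P (dual (oddidx n i))) ->
  forall x, P x.
Proof.
move=> Pe Pe' Po Po' x; have xN := index_bound x.
have [x1|x1] := ltnP x n.
  by rewrite (_ : x = evidx m (Ordinal x1)) //; apply/val_inj.
have [x2|x2] := ltnP x (n + n).
  have h : (x - n < n)%N by lia.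
  rewrite (_ : x = dual (evidx m (Ordinal h))) //; apply/val_inj.
  by rewrite /= /dual_nat /= h; lia.
have [x3|x3] := ltnP x (n + n + m).
  have h : (x - (n + n) < m)%N by lia.
  rewrite (_ : x = oddidx n (Ordinal h)) //; apply/val_inj => /=; lia.
have h : (x - (n + n + m) < m)%N by lia.
rewrite (_ : x = dual (oddidx n (Ordinal h))) //; apply/val_inj.
by rewrite /= /dual_nat /=; do ?[case: ifP => ?]; lia.
Qed.

(* The grading of C^{2n|2m} with [p i] in the direction of [eps i] and [q j]
   in the direction of [del j]. *)
Definition sval (Z : zmodType) (p q : nat -> Z) x : Z :=
  if (x < n)%N then q x else if (x < n + n)%N then - q (x - n)%N
  else if (x < n + n + m)%N then p (x - (n + n))%N else - p (x - (n + n + m))%N.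

Lemma sval_evidx (Z : zmodType) (p q : nat -> Z) (j : 'I_n) :
  sval p q (evidx m j) = q j.
Proof. by rewrite /sval /= ltn_ord. Qed.

Lemma sval_oddidx (Z : zmodType) (p q : nat -> Z) (i : 'I_m) :
  sval p q (oddidx n i) = p i.
Proof.
have := ltn_ord i; rewrite /sval /=; do ?[case: ifP => ?]; try lia.
by move=> _; congr p; lia.
Qed.

Lemma sval_dual (Z : zmodType) (p q : nat -> Z) x :
  sval p q (dual x) = - sval p q x.
Proof.
have xN := index_bound x; rewrite /sval /= /dual_nat.
have [x1|x1] := ltnP x n.
  have -> : (x + n < n)%N = false by lia.
  have -> : (x + n < n + n)%N = true by lia.
  by rewrite addnK.
have [x2|x2] := ltnP x (n + n).
  have -> : (x - n < n)%N = true by lia.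
  by rewrite opprK.
have [x3|x3] := ltnP x (n + n + m).
  have -> : (x + m < n)%N = false by lia.
  have -> : (x + m < n + n)%N = false by lia.
  have -> : (x + m < n + n + m)%N = false by lia.
  by congr (- p _); lia.
have -> : (x - m < n)%N = false by lia.
have -> : (x - m < n + n)%N = false by lia.
have -> : (x - m < n + n + m)%N = true by lia.
by rewrite opprK; congr p; lia.
Qed.

End Index.

Section Osp.
Variables m n : nat.
Local Notation N := (NN m n).
Implicit Types (x y z : 'I_N) (X Y : 'M[C]_N).

(** The sign relating the entries at (x, y) and (dual y, dual x) of a matrix of osp. It does not
    mention the parity of the matrix, because a nonzero entry determines that parity as
    [par x (+) par y]; one coefficient thus serves even and odd elements. *)
Definition osp_coef x y : C :=
  - (-1) ^+ (par x && ~~ par y) * sgnJ (dual x) * sgnJ (dual y).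

Lemma osp_hP b X : osp_h b X <->
  homog b X /\ forall x y, X (dual y) (dual x) = osp_coef x y * X x y.
Proof.
have trJ x y : (X^T *m Jform m n) x y = X (dual y) x * sgnJ (dual y).
  rewrite mxE (bigD1 (dual y)) //= big1 => [|z zy].
    by rewrite addr0 mxE JformE dualK eqxx mulr1.
  by rewrite JformE dual_eqC eq_sym (negbTE zy) !mulr0.
have Jm x y : (Jform m n *m X) x y = sgnJ x * X (dual x) y.
  rewrite mxE (bigD1 (dual x)) //= big1 => [|z zx].
    by rewrite addr0 JformE eqxx mulr1.
  by rewrite JformE (negbTE zx) mulr0 mul0r.
split=> -[hX symX]; split=> // x y.
- have := symX (dual x) y; rewrite trJ Jm dualK par_dual => /eqP.
  rewrite addr_eq0 => /eqP/(congr1 (fun c => c * sgnJ (dual y))).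
  rewrite -mulrA sgnJ_sq mulr1 => ->; rewrite /osp_coef.
  have [->|Xxy] := eqVneq (X x y) 0; first by rewrite !mulr0 oppr0 mul0r.
  suff -> : b && par x = par x && ~~ par y by ring.
  have -> : b = par x (+) par y.
    by apply/eqP; apply: contraNT Xxy => h; rewrite hX // eq_sym.
  by case: (par x); case: (par y).
- rewrite trJ Jm -{1}[x]dualK symX /osp_coef dualK par_dual.
  have [->|Xxy] := eqVneq (X (dual x) y) 0; first by rewrite !mulr0 mul0r addr0.
  have -> : b && par x = par x && ~~ par y.
    have -> : b = par x (+) par y.
      by apply/eqP; apply: contraNT Xxy => h; rewrite hX // par_dual eq_sym.
    by case: (par x); case: (par y).
  have sq := sgnJ_sq (dual y).
  transitivity (sgnJ x * X (dual x) y * (-1) ^+ (par x && ~~ par y)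
     * (1 - sgnJ (dual y) * sgnJ (dual y))); first by ring.
  by rewrite sq subrr mulr0.
Qed.

Lemma osp_coef_dual x y : osp_coef (dual y) (dual x) * osp_coef x y = 1.
Proof.
rewrite /osp_coef !dualK !par_dual.
rewrite (sgnJ_dual x) (sgnJ_dual y).
have sx := sgnJ_sq x; have sy := sgnJ_sq y.
transitivity ((-1) ^+ (par y && ~~ par x) * (-1) ^+ (par x && ~~ par y)
  * (-1) ^+ par x * (-1) ^+ par y * (sgnJ x * sgnJ x) * (sgnJ y * sgnJ y)); first by ring.
by rewrite sx sy; case: (par x); case: (par y); rewrite /= ?expr0 ?expr1; ring.
Qed.

(** The elementary matrix completed to an element of osp. For x different from y it is zero or a
    root vector for the difference of the weights of [x] and [y]; these matrices span osp, and all
    statements about osp are reduced to them. *)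
Definition ospF x y : 'M[C]_N :=
  delta_mx x y + osp_coef x y *: delta_mx (dual y) (dual x).

Lemma ospF_neq0 x y z t : ospF x y z t != 0 ->
  (z = x /\ t = y) \/ (z = dual y /\ t = dual x).
Proof.
rewrite !mxE; have [/andP[/eqP -> /eqP ->]|_] := boolP ((z == x) && (t == y)).
  by left.
have [/andP[/eqP -> /eqP ->]|_] := boolP ((z == dual y) && (t == dual x)).
  by right.
by rewrite mulr0 addr0 eqxx.
Qed.

Lemma osp_h_ospF x y : osp_h (par x (+) par y) (ospF x y).
Proof.
apply/osp_hP; split=> z t.
  move=> hzt; apply/eqP; apply: contraNT hzt => /ospF_neq0.
  by case=> -[-> ->]; rewrite ?par_dual // addbC.
rewrite !mxE !dual_eq -!dual_eqC [(t == dual x) && _]andbC [(t == y) && _]andbC.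
have [/andP[/eqP zE /eqP tE]|_] := boolP ((z == dual y) && (t == dual x));
  have [/andP[/eqP zx /eqP ty]|_] := boolP ((z == x) && (t == y)).
- rewrite !mulr1 mulrDr mulr1 {2}zE {2}tE osp_coef_dual [in RHS]addrC.
  by rewrite zx ty.
- by rewrite mulr0 addr0 add0r mulr1 zE tE osp_coef_dual.
- by rewrite zx ty mulr0 addr0 add0r !mulr1.
- by rewrite !mulr0 addr0 mulr0.
Qed.

(** The double sum symmetrises [X] under the involution defining osp. As [X] is already invariant,
    the result is [X + X], whence the factor 1/2. *)
Lemma osp_h_expand b X : osp_h b X ->
  X = 2^-1 *: \sum_x \sum_y X x y *: ospF x y.
Proof.
move=> /osp_hP[_ symX].
have -> : \sum_x \sum_y X x y *: ospF x y = X + X; last first.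
  by rewrite scalerDr -scalerDl -div1r -splitr scale1r.
have {1}-> : X + X = X + \sum_x \sum_y X (dual y) (dual x) *: delta_mx (dual y) (dual x).
  congr (_ + _); rewrite {1}[X]matrix_sum_delta exchange_big /=.
  rewrite (reindex_inj (inv_inj (@dualK m n))) /=; apply: eq_bigr => x _.
  by rewrite (reindex_inj (inv_inj (@dualK m n))) /=; apply: eq_bigr => y _.
rewrite [A in _ = A + _]matrix_sum_delta -big_split; apply: eq_bigr => x _.
rewrite -big_split; apply: eq_bigr => y _ /=.
by rewrite symX /ospF scalerDr scalerA mulrC.
Qed.

Definition sbracket (b1 b2 : bool) X Y : 'M[C]_N :=
  X *m Y - (-1) ^+ (b1 && b2) *: (Y *m X).

Lemma sbracketE b1 b2 X Y x y : sbracket b1 b2 X Y x y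
  = (X *m Y) x y - (-1) ^+ (b1 && b2) * (Y *m X) x y.
Proof. by rewrite !mxE. Qed.

(** The supertranspose reverses products up to sign, and elements of osp are those it negates.
    Closure under the superbracket follows from this identity. *)
Lemma osp_mul_dual b1 b2 X Y x y : osp_h b1 X -> osp_h b2 Y ->
  (X *m Y) (dual y) (dual x)
  = - ((-1) ^+ (b1 && b2)) * osp_coef x y * (Y *m X) x y.
Proof.
move=> /osp_hP[hX symX] /osp_hP[hY symY].
rewrite !mxE (reindex_inj (inv_inj (@dualK m n))) /= big_distrr /=.
apply: eq_bigr => z _; rewrite symX symY.
have [->|Xn0] := eqVneq (X z y) 0; first by rewrite !(mulr0, mul0r).
have [->|Yn0] := eqVneq (Y x z) 0; first by rewrite !(mulr0, mul0r).
have -> : b1 = par z (+) par y.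
  by apply/eqP; apply: contraNT Xn0 => h; rewrite hX // eq_sym.
have -> : b2 = par x (+) par z.
  by apply/eqP; apply: contraNT Yn0 => h; rewrite hY // eq_sym.
rewrite /osp_coef; have sz := sgnJ_sq (dual z).
transitivity ((-1) ^+ (par z && ~~ par y) * (-1) ^+ (par x && ~~ par z)
  * (sgnJ (dual z) * sgnJ (dual z)) * sgnJ (dual x) * sgnJ (dual y) * X z y * Y x z).
  by ring.
rewrite sz; case: (par x); case: (par y); case: (par z); rewrite /= ?expr0 ?expr1; ring.
Qed.

Lemma homog_mul b1 b2 X Y : homog b1 X -> homog b2 Y -> homog (b1 (+) b2) (X *m Y).
Proof.
move=> hX hY x y hxy; rewrite mxE big1 // => z _.
have [/hX->|e1] := boolP (par x (+) par z != b1); first by rewrite mul0r.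
have [/hY->|e2] := boolP (par z (+) par y != b2); first by rewrite mulr0.
move: hxy; rewrite -(eqP (negPn e1)) -(eqP (negPn e2)).
by rewrite addbA -[par x (+) _ (+) _]addbA addbb addbF eqxx.
Qed.

Lemma osp_h_bracket b1 b2 X Y : osp_h b1 X -> osp_h b2 Y ->
  osp_h (b1 (+) b2) (sbracket b1 b2 X Y).
Proof.
move=> oX oY; have [hX _] := oX; have [hY _] := oY.
apply/osp_hP; split=> x y.
  move=> hxy; rewrite sbracketE (homog_mul hX hY) // (homog_mul hY hX) ?mulr0 ?subr0 //.
  by rewrite [b2 (+) _]addbC.
rewrite !sbracketE.
rewrite (osp_mul_dual x y oX oY) (osp_mul_dual x y oY oX) [b2 && b1]andbC.
have sq : (-1) ^+ (b1 && b2) * (-1) ^+ (b1 && b2) = 1 :> C.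
  by case: (b1 && b2); rewrite ?expr0 ?expr1 ?mulrNN mulr1.
transitivity (((-1) ^+ (b1 && b2) * (-1) ^+ (b1 && b2)) * osp_coef x y * (X *m Y) x y
  - (-1) ^+ (b1 && b2) * osp_coef x y * (Y *m X) x y); first by ring.
by rewrite sq; ring.
Qed.

Section Hom.
Variables (Z : zmodType).

(* [X] lies in the component of degree [a] of the grading of matrices induced
   by the grading [psi] of the index set. *)
Definition hom (psi : 'I_N -> Z) (a : Z) X : Prop :=
  forall x y, X x y != 0 -> psi x - psi y = a.

Variable psi : 'I_N -> Z.

Lemma hom_mul a b X Y : hom psi a X -> hom psi b Y -> hom psi (a + b) (X *m Y).
Proof.
move=> hX hY x y; rewrite mxE => nz.
have [z] : exists z, X x z * Y z y != 0.
  apply/existsP; apply: contraNT nz => /existsPn h.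
  by rewrite big1 // => z _; apply/eqP; have:= h z; rewrite negbK.
rewrite mulf_eq0 negb_or => /andP[/hX <- /hY <-].
by rewrite addrA subrK.
Qed.

Lemma hom_bracket b1 b2 a b X Y : hom psi a X -> hom psi b Y ->
  hom psi (a + b) (sbracket b1 b2 X Y).
Proof.
move=> hX hY x y nz.
have [nz1|/negPn/eqP z1] := boolP ((X *m Y) x y != 0); first exact: (hom_mul hX hY).
apply: (_ : hom psi (a + b) (Y *m X)); first by rewrite addrC; apply: hom_mul.
by apply: contraNneq nz => z2; rewrite sbracketE z1 z2 mulr0 subr0.
Qed.

Lemma hom_gform a b X Y : hom psi a X -> hom psi b Y -> gform X Y != 0 -> a + b = 0.
Proof.
move=> hX hY nz; have hXY := hom_mul hX hY.
have [x] : exists x, (X *m Y) x x != 0.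
  apply/existsP; apply: contraNT nz => /existsPn h.
  by rewrite /gform big1 // => z _; have:= h z; rewrite negbK => /eqP->; rewrite mulr0.
by move=> /hXY <-; rewrite subrr.
Qed.

Hypothesis psi_dual : forall x, psi (dual x) = - psi x.

Lemma hom_ospF x y : hom psi (psi x - psi y) (ospF x y).
Proof.
by move=> z t /ospF_neq0[] [-> ->] //; rewrite !psi_dual opprK addrC.
Qed.

End Hom.

End Osp.

(** * Weights *)

Section Weights.
Variables m n : nat.
Local Notation N := (NN m n).
Implicit Types (x y z : 'I_N) (X Y H : 'M[C]_N) (mu nu u v w : 'rV[C]_(m + n)).

Lemma osp_of_h b X : osp_h b X -> osp X.
Proof.
have z0 c : osp_h c (0 : 'M[C]_N).
  split=> x y; first by rewrite mxE.
  by rewrite trmx0 mul0mx mulmx0 !mxE mulr0 addr0.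
by case: b => hX; [exists 0, X | exists X, 0]; rewrite ?addr0 ?add0r.
Qed.

Lemma osp_homog b X : osp X -> homog b X -> osp_h b X.
Proof.
move=> [X0 [X1 [-> [o0 o1]]]] hX.
have [h0 _] := o0; have [h1 _] := o1.
case: b hX => hX.
  suff z : X0 = 0 by rewrite z add0r.
  apply/matrixP => x y; rewrite [RHS]mxE.
  have [p|p] := boolP (par x (+) par y != false); first exact: h0.
  by have := hX x y; rewrite mxE (h1 x y) ?addr0 => [->|] //; move: p; case: addb.
suff z : X1 = 0 by rewrite z addr0.
apply/matrixP => x y; rewrite [RHS]mxE.
have [p|p] := boolP (par x (+) par y != true); first exact: h1.
by have := hX x y; rewrite mxE (h0 x y) ?add0r => [->|] //; move: p; case: addb.
Qed.

Lemma cartan_offdiag H x y : cartan H -> x != y -> H x y = 0.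
Proof. by move=> [/is_diag_mxP d _] xy; apply: d; rewrite val_eqE. Qed.

Lemma cartan_osp_h H : cartan H -> osp_h false H.
Proof.
move=> cH; apply: osp_homog => [|x y]; first by case: cH.
move=> hxy; apply: cartan_offdiag => //.
by apply: contraNneq hxy => ->; rewrite addbb.
Qed.

Lemma osp_coef_diag x : osp_coef x x = -1.
Proof. by rewrite /osp_coef andbN expr0 -mulrA sgnJ_sq mulr1. Qed.

Lemma cartan_dual H x : cartan H -> H (dual x) (dual x) = - H x x.
Proof.
by move=> /cartan_osp_h/osp_hP[_ ->]; rewrite osp_coef_diag mulN1r.
Qed.

Definition hdiag (psi : 'I_N -> C) : 'M[C]_N := diag_mx (\row_x psi x).

Lemma hdiagE psi x : hdiag psi x x = psi x.
Proof. by rewrite !mxE eqxx. Qed.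

Lemma cartan_hdiag psi : (forall x, psi (dual x) = - psi x) -> cartan (hdiag psi).
Proof.
move=> psiD; split; first exact: diag_mx_is_diag.
apply: (@osp_of_h false); apply/osp_hP.
have off x y : x != y -> hdiag psi x y = 0.
  by move=> xy; rewrite !mxE (negbTE xy).
split=> x y.
  move=> hxy; apply: off; apply: contraNneq hxy => ->; by rewrite addbb.
have [->|xy] := eqVneq x y; first by rewrite !hdiagE psiD osp_coef_diag mulN1r.
by rewrite !off ?mulr0 // dual_eq eq_sym.
Qed.

Definition wtx : 'I_N -> 'rV[C]_(m + n) := sval (eps m n) (del m n).

Lemma wtx_dual x : wtx (dual x) = - wtx x.
Proof. exact: sval_dual. Qed.

Lemma wt_evalP a mu nu H :
  wt_eval (a *: mu + nu) H = a * wt_eval mu H + wt_eval nu H.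
Proof.
rewrite /wt_eval mulrDr !mulr_sumr addrACA -!big_split /=.
by congr (_ + _); apply: eq_bigr => i _; rewrite !mxE; ring.
Qed.

Lemma wt_evalD mu nu H : wt_eval (mu + nu) H = wt_eval mu H + wt_eval nu H.
Proof. by have := wt_evalP 1 mu nu H; rewrite scale1r mul1r. Qed.

Lemma wt_eval0 H : wt_eval 0 H = 0.
Proof. by have /esym/eqP := wt_evalD 0 0 H; rewrite addr0 -subr_eq0 addrK => /eqP. Qed.

Lemma wt_evalZ a mu H : wt_eval (a *: mu) H = a * wt_eval mu H.
Proof. by have := wt_evalP a mu 0 H; rewrite wt_eval0 !addr0. Qed.

Lemma wt_evalN mu H : wt_eval (- mu) H = - wt_eval mu H.
Proof. by rewrite -scaleN1r wt_evalZ mulN1r. Qed.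

Lemma wt_evalB mu nu H : wt_eval (mu - nu) H = wt_eval mu H - wt_eval nu H.
Proof. by rewrite wt_evalD wt_evalN. Qed.

Lemma epsE (i : nat) (j : 'I_m) : eps m n i 0 (lshift n j) = (j == i :> nat)%:R.
Proof.
rewrite mxE /=; case: eqP => //= e; rewrite -e; have /= -> := ltn_ord j; done.
Qed.

Lemma epsE0 (i : nat) (j : 'I_n) : eps m n i 0 (rshift m j) = 0.
Proof.
rewrite mxE /=; case: eqP => //= e; rewrite -e.
by rewrite ltnNge leq_addr.
Qed.

Lemma delE (i : nat) (j : 'I_n) : del m n i 0 (rshift m j) = (j == i :> nat)%:R.
Proof.
rewrite mxE /= eqn_add2l; case: eqP => //= e; rewrite -e; have /= -> := ltn_ord j; done.
Qed.

Lemma delE0 (i : nat) (j : 'I_m) : del m n i 0 (lshift n j) = 0.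
Proof.
rewrite mxE /=; case: eqP => //= e; have := ltn_ord j; rewrite e.
by rewrite ltnNge leq_addr.
Qed.

Lemma sum_delta k (i : 'I_k) (f : 'I_k -> C) : \sum_(j < k) (j == i :> nat)%:R * f j = f i.
Proof.
rewrite (bigD1 i) //= eqxx mul1r big1 ?addr0 // => j ji.
by rewrite -val_eqE in ji; rewrite (negbTE ji) mul0r.
Qed.

Lemma wtx_evidx (j : 'I_n) : wtx (evidx m j) = del m n j.
Proof. exact: sval_evidx. Qed.

Lemma wtx_oddidx (i : 'I_m) : wtx (oddidx n i) = eps m n i.
Proof. exact: sval_oddidx. Qed.

Lemma wt_eval_eps (i : 'I_m) H : wt_eval (eps m n i) H = H (oddidx n i) (oddidx n i).
Proof.
rewrite /wt_eval [X in _ + X]big1 ?addr0 => [|j _]; last by rewrite epsE0 mul0r.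
under eq_bigr do rewrite epsE.
exact: (sum_delta i (fun j => H (oddidx n j) (oddidx n j))).
Qed.

Lemma wt_eval_del (j : 'I_n) H : wt_eval (del m n j) H = H (evidx m j) (evidx m j).
Proof.
rewrite /wt_eval [X in X + _]big1 ?add0r => [|i _]; last by rewrite delE0 mul0r.
under eq_bigr do rewrite delE.
exact: (sum_delta j (fun j => H (evidx m j) (evidx m j))).
Qed.

Lemma wt_eval_wtx x H : cartan H -> wt_eval (wtx x) H = H x x.
Proof.
move=> cH; elim/index_ind: x => [j|j|i|i].
- by rewrite wtx_evidx wt_eval_del.
- by rewrite wtx_dual wt_evalN wtx_evidx wt_eval_del cartan_dual.
- by rewrite wtx_oddidx wt_eval_eps.
- by rewrite wtx_dual wt_evalN wtx_oddidx wt_eval_eps cartan_dual.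
Qed.

Lemma hom_rootsp alpha X : osp X -> hom wtx alpha X -> rootsp alpha X.
Proof.
move=> oX hX; split=> // H cH; apply/matrixP => x y.
rewrite !mxE (bigD1 x) //= big1 => [|z zx]; last first.
  by rewrite (cartan_offdiag cH) ?mul0r // eq_sym.
rewrite (bigD1 y) //= big1 => [|z zx]; last first.
  by rewrite (cartan_offdiag cH) ?mulr0.
have [->|nz] := eqVneq (X x y) 0; first by rewrite !mulr0 mul0r !addr0 subr0.
by rewrite -(hX _ _ nz) wt_evalB !wt_eval_wtx //; ring.
Qed.

Lemma osp_ospF x y : osp (ospF x y).
Proof. exact: osp_of_h (osp_h_ospF x y). Qed.

Lemma rootsp_ospF x y : rootsp (wtx x - wtx y) (ospF x y).
Proof.
by apply: hom_rootsp; [exact: osp_ospF|apply: hom_ospF; exact: wtx_dual].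
Qed.

Lemma hformP a u v w : hform (a *: u + v) w = a * hform u w + hform v w.
Proof.
rewrite /hform mulrCA -mulrDr; congr (_ * _).
rewrite mulrBr addrACA -opprD !mulr_sumr -!big_split /=.
by congr (_ - _); apply: eq_bigr => i _; rewrite !mxE; ring.
Qed.

Lemma hformC u v : hform u v = hform v u.
Proof.
by rewrite /hform; congr (_ * (_ - _)); apply: eq_bigr => i _; rewrite mulrC.
Qed.

Lemma hformDl u v w : hform (u + v) w = hform u w + hform v w.
Proof. by have := hformP 1 u v w; rewrite scale1r mul1r. Qed.

Lemma hform0l w : hform (0 : 'rV_(m + n)) w = 0.
Proof. by have /esym/eqP := hformDl 0 0 w; rewrite addr0 -subr_eq0 addrK => /eqP. Qed.

Lemma hformZl a u w : hform (a *: u) w = a * hform u w.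
Proof. by have := hformP a u 0 w; rewrite hform0l !addr0. Qed.

Lemma hformNl u w : hform (- u) w = - hform u w.
Proof. by rewrite -scaleN1r hformZl mulN1r. Qed.

Lemma hformBl u v w : hform (u - v) w = hform u w - hform v w.
Proof. by rewrite hformDl hformNl. Qed.

Lemma hformDr u v w : hform w (u + v) = hform w u + hform w v.
Proof. by rewrite hformC hformDl ![hform _ w]hformC. Qed.

Lemma hformZr a u w : hform w (a *: u) = a * hform w u.
Proof. by rewrite hformC hformZl hformC. Qed.

Lemma hformNr u w : hform w (- u) = - hform w u.
Proof. by rewrite hformC hformNl hformC. Qed.

Lemma hformBr u v w : hform w (u - v) = hform w u - hform w v.
Proof. by rewrite hformDr hformNr. Qed.

Lemma hform_eps (i : 'I_m) mu : hform (eps m n i) mu = 2^-1 * mu 0 (lshift n i).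
Proof.
rewrite /hform [X in _ - X]big1 ?subr0 => [|j _]; last by rewrite epsE0 mul0r.
under eq_bigr do rewrite epsE; congr (_ * _).
exact: (sum_delta i (fun j => mu 0 (lshift n j))).
Qed.

Lemma hform_del (j : 'I_n) mu : hform (del m n j) mu = - (2^-1 * mu 0 (rshift m j)).
Proof.
rewrite /hform [X in X - _]big1 ?sub0r => [|i _]; last by rewrite delE0 mul0r.
under eq_bigr do rewrite delE; rewrite mulrN; congr (- (_ * _)).
exact: (sum_delta j (fun j => mu 0 (rshift m j))).
Qed.

Lemma hform_eps_eps i j : (i < m)%N ->
  hform (eps m n i) (eps m n j) = 2^-1 * (i == j)%:R.
Proof. by move=> im; rewrite (hform_eps (Ordinal im)) epsE. Qed.

(** For odd [x] this is the coroot of the long root [2 *: wtx x]. For the other root vectors, the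
    bracket of opposite ones is a sum or difference of two such elements. *)
Definition coroot x : 'M[C]_N := delta_mx x x - delta_mx (dual x) (dual x).

Lemma corootE x : coroot x = hdiag (fun z => (z == x)%:R - (z == dual x)%:R).
Proof.
apply/matrixP => y z; rewrite !mxE.
have [->|yz] := eqVneq y z; first by rewrite !andbb mulr1n.
have off t : (y == t) && (z == t) = false.
  by apply: contraNF yz => /andP[/eqP -> /eqP ->].
by rewrite !off subrr mulr0n.
Qed.

Lemma coroot_psi_dual x z :
  (dual z == x)%:R - (dual z == dual x)%:R = - ((z == x)%:R - (z == dual x)%:R) :> C.
Proof. by rewrite dual_eq -dual_eqC opprB. Qed.

Lemma cartan_coroot x : cartan (coroot x).
Proof. by rewrite corootE; apply: cartan_hdiag => z; apply: coroot_psi_dual. Qed.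

Lemma wt_eval_hdiag mu (p q : nat -> C) :
  wt_eval mu (hdiag (sval p q)) =
  \sum_(i < m) mu 0 (lshift n i) * p i + \sum_(j < n) mu 0 (rshift m j) * q j.
Proof.
by congr (_ + _); apply: eq_bigr => i _; rewrite hdiagE ?sval_oddidx ?sval_evidx.
Qed.

Lemma coroot_dual x : coroot (dual x) = - coroot x.
Proof. by rewrite /coroot dualK opprB. Qed.

Lemma wt_eval_opp mu H : wt_eval mu (- H) = - wt_eval mu H.
Proof.
rewrite /wt_eval opprD -!sumrN.
by congr (_ + _); apply: eq_bigr => i _; rewrite mxE mulrN.
Qed.

Lemma evidx_neq_odd (j : 'I_n) (i : 'I_m) : (evidx m j == oddidx n i) = false.
Proof. by apply: contraFF (par_evidx m j) => /eqP ->; rewrite par_oddidx. Qed.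

Lemma evidx_neq_odd_dual (j : 'I_n) (i : 'I_m) : (evidx m j == dual (oddidx n i)) = false.
Proof.
by apply: contraFF (par_evidx m j) => /eqP ->; rewrite par_dual par_oddidx.
Qed.

Lemma oddidx_neq_evidx (j : 'I_n) (i : 'I_m) : (oddidx n i == evidx m j) = false.
Proof. by rewrite eq_sym evidx_neq_odd. Qed.

Lemma oddidx_neq_evidx_dual (j : 'I_n) (i : 'I_m) : (oddidx n i == dual (evidx m j)) = false.
Proof. by rewrite dual_eqC eq_sym evidx_neq_odd_dual. Qed.

Lemma evidx_neq_dual (j k : 'I_n) : (evidx m j == dual (evidx m k)) = false.
Proof.
apply/negbTE; rewrite -val_eqE /= /dual_nat /= ltn_ord.
by have := ltn_ord j; lia.
Qed.

Lemma oddidx_neq_dual (i k : 'I_m) : (oddidx n i == dual (oddidx n k)) = false.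
Proof.
apply/negbTE; rewrite -val_eqE /= /dual_nat /=.
have := ltn_ord i; have := ltn_ord k; do ?[case: ifP => ?]; lia.
Qed.

Lemma coroot_evidx (j : 'I_n) :
  coroot (evidx m j) = hdiag (sval (fun=> 0) (fun k => (k == j :> nat)%:R)).
Proof.
rewrite corootE; apply/matrixP => y z; rewrite !mxE; congr (_ *+ _).
elim/index_ind: y => [k|k|k|k]; rewrite ?coroot_psi_dual ?sval_dual.
- by rewrite sval_evidx evidx_neq_dual subr0 -val_eqE.
- by rewrite sval_evidx evidx_neq_dual subr0 -val_eqE.
- by rewrite sval_oddidx oddidx_neq_evidx oddidx_neq_evidx_dual subr0.
- by rewrite sval_oddidx oddidx_neq_evidx oddidx_neq_evidx_dual subr0.
Qed.

Lemma coroot_oddidx (i : 'I_m) :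
  coroot (oddidx n i) = hdiag (sval (fun k => (k == i :> nat)%:R) (fun=> 0)).
Proof.
rewrite corootE; apply/matrixP => y z; rewrite !mxE; congr (_ *+ _).
elim/index_ind: y => [k|k|k|k]; rewrite ?coroot_psi_dual ?sval_dual.
- by rewrite sval_evidx evidx_neq_odd evidx_neq_odd_dual subr0.
- by rewrite sval_evidx evidx_neq_odd evidx_neq_odd_dual subr0.
- by rewrite sval_oddidx oddidx_neq_dual subr0 -val_eqE /= eqn_add2l.
- by rewrite sval_oddidx oddidx_neq_dual subr0 -val_eqE /= eqn_add2l.
Qed.

(** The sign is that of the norm of [wtx x], which is 1/2 on the [eps] and -1/2 on the [del]. *)
Lemma wt_eval_coroot mu x :
  wt_eval mu (coroot x) = - (-1) ^+ par x * 2 * hform mu (wtx x).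
Proof.
have evE (j : 'I_n) : wt_eval mu (coroot (evidx m j)) = mu 0 (rshift m j).
  rewrite coroot_evidx wt_eval_hdiag big1 ?add0r => [|i _]; last by rewrite mulr0.
  under eq_bigr do rewrite mulrC; exact: (sum_delta j (fun j => mu 0 (rshift m j))).
have oddE (i : 'I_m) : wt_eval mu (coroot (oddidx n i)) = mu 0 (lshift n i).
  rewrite coroot_oddidx wt_eval_hdiag addrC big1 ?add0r => [|j _]; last by rewrite mulr0.
  under eq_bigr do rewrite mulrC; exact: (sum_delta i (fun i => mu 0 (lshift n i))).
elim/index_ind: x => [j|j|i|i].
- by rewrite evE par_evidx wtx_evidx hformC hform_del expr0; field.
- rewrite coroot_dual wt_eval_opp evE par_dual par_evidx wtx_dual wtx_evidx hformNr.
  by rewrite hformC hform_del expr0; field.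
- by rewrite oddE par_oddidx wtx_oddidx hformC hform_eps expr1; field.
- rewrite coroot_dual wt_eval_opp oddE par_dual par_oddidx wtx_dual wtx_oddidx hformNr.
  by rewrite hformC hform_eps expr1; field.
Qed.
End Weights.

(** * Brackets of opposite root vectors *)

Section Brackets.
Variables m n : nat.
Local Notation N := (NN m n).
Implicit Types (x y z : 'I_N) (X Y : 'M[C]_N).

Lemma osp_h_lin b a X Y : osp_h b X -> osp_h b Y -> osp_h b (a *: X + Y).
Proof.
move=> /osp_hP[hX sX] /osp_hP[hY sY]; apply/osp_hP; split=> x y.
  by move=> p; rewrite !mxE hX // hY // mulr0 addr0.
by rewrite !mxE sX sY; ring.
Qed.

Lemma osp_lin a X Y : osp X -> osp Y -> osp (a *: X + Y).
Proof.
move=> [X0 [X1 [-> [x0 x1]]]] [Y0 [Y1 [-> [y0 y1]]]].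
exists (a *: X0 + Y0), (a *: X1 + Y1); split; first by rewrite scalerDr addrACA.
by split; apply: osp_h_lin.
Qed.

Lemma osp0 : osp (0 : 'M[C]_N).
Proof.
apply: (@osp_of_h _ _ false); apply/osp_hP.
by split=> x y; rewrite !mxE ?mulr0.
Qed.

Lemma osp_sum (I : Type) (s : seq I) (c : I -> C) (Y : I -> 'M[C]_N) :
  (forall i, osp (Y i)) -> osp (\sum_(i <- s) c i *: Y i).
Proof.
move=> oY; elim: s => [|i s IH]; rewrite ?big_nil ?big_cons; first exact: osp0.
exact: osp_lin.
Qed.

Lemma osp_split X : osp X -> exists X0 X1,
  [/\ X = X0 + X1, osp_h false X0, osp_h true X1,
   (forall x y, X0 x y != 0 -> X x y != 0) & (forall x y, X1 x y != 0 -> X x y != 0)].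
Proof.
move=> [X0 [X1 [-> [o0 o1]]]]; have [h0 _] := o0; have [h1 _] := o1.
exists X0, X1; split=> // x y; rewrite mxE.
  have [p|p] := boolP (par x (+) par y != false); first by rewrite h0 // eqxx.
  by rewrite (h1 x y) ?addr0 //; move: p; case: addb.
have [p|p] := boolP (par x (+) par y != true); first by rewrite h1 // eqxx.
by rewrite (h0 x y) ?add0r //; move: p; case: addb.
Qed.

Lemma osp_coef_swap x y :
  osp_coef x y * osp_coef y x = (-1) ^+ (par x (+) par y).
Proof.
have sx := sgnJ_sq (dual x); have sy := sgnJ_sq (dual y).
transitivity ((-1) ^+ (par x && ~~ par y) * (-1) ^+ (par y && ~~ par x)
  * (sgnJ (dual x) * sgnJ (dual x)) * (sgnJ (dual y) * sgnJ (dual y))).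
  by rewrite /osp_coef; ring.
by rewrite sx sy; case: (par x); case: (par y); rewrite /= ?expr0 ?expr1; ring.
Qed.

Lemma ospF_mul x y : y != dual x ->
  ospF x y *m ospF y x =
  delta_mx x x + (-1) ^+ (par x (+) par y) *: delta_mx (dual y) (dual y).
Proof.
move=> yx; rewrite /ospF mulmxDl !mulmxDr -!scalemxAl -!scalemxAr scalerA.
rewrite !mul_delta_mx_cond !eqxx osp_coef_swap.
rewrite [dual x == y]eq_sym (negbTE yx).
by rewrite !mulr0n !scaler0 addr0 add0r !mulr1n.
Qed.

Lemma bracket_ospF x y (b := par x (+) par y) : y != dual x ->
  sbracket b b (ospF x y) (ospF y x) = coroot x - (-1) ^+ b *: coroot y.
Proof.
move=> yx; have xy : x != dual y by rewrite dual_eqC eq_sym.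
rewrite /sbracket /b andbb (ospF_mul yx) (ospF_mul xy).
rewrite [par y (+) _]addbC /coroot !scalerDr scalerA -signr_addb addbb expr0 scale1r scalerN.
by rewrite opprB [RHS]addrACA -opprD [delta_mx (dual x) _ + _]addrC.
Qed.

Lemma osp_coef_dualr x : osp_coef x (dual x) = - (-1) ^+ par x.
Proof.
have sx := sgnJ_sq x.
rewrite /osp_coef par_dual andbN expr0 dualK sgnJ_dual.
transitivity (- (-1) ^+ par x * (sgnJ x * sgnJ x)); first by ring.
by rewrite sx mulr1.
Qed.

(** For [y = dual x] the two terms of [ospF] are multiples of the same elementary matrix. They add
    up when [x] is odd and cancel when [x] is even, where twice the weight is not a root. The
    doubling is the source of the factor 4 in [bracket_long], [gform_long] and [sl2_long]. *)
Lemma ospF_long x : par x -> ospF x (dual x) = 2 *: delta_mx x (dual x).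
Proof.
move=> px; rewrite /ospF dualK osp_coef_dualr px expr1 opprK.
by rewrite scale1r [2]mulr2n scalerDl !scale1r.
Qed.

Lemma ospF_evdual x : ~~ par x -> ospF x (dual x) = 0.
Proof.
move=> px; rewrite /ospF dualK osp_coef_dualr (negbTE px) expr0.
by rewrite scaleN1r subrr.
Qed.

Lemma ospF_long_dual x : par x -> ospF (dual x) x = 2 *: delta_mx (dual x) x.
Proof. by move=> px; have := @ospF_long (dual x); rewrite par_dual dualK; apply. Qed.

Lemma long_mul x : par x ->
  ospF x (dual x) *m ospF (dual x) x = 4 *: delta_mx x x.
Proof.
move=> px; rewrite ospF_long // ospF_long_dual //.
rewrite -scalemxAl -scalemxAr scalerA mul_delta_mx.
by congr (_ *: _); ring.
Qed.

Lemma bracket_long x : par x ->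
  sbracket false false (ospF x (dual x)) (ospF (dual x) x) = 4 *: coroot x.
Proof.
move=> px; rewrite /sbracket expr0 scale1r long_mul //.
have := @long_mul (dual x); rewrite par_dual dualK => -> //.
by rewrite -scalerBr.
Qed.

Lemma gform_long x : par x -> gform (ospF x (dual x)) (ospF (dual x) x) = 4.
Proof.
move=> px; rewrite /gform long_mul // (bigD1 x) //= px big1 => [|z zx].
  by rewrite !mxE !eqxx mul1r mulr1 addr0.
by rewrite !mxE (negbTE zx) !mulr0.
Qed.

End Brackets.

(** * Highest weight modules *)

Section Module.
Variables (m n : nat) (V : lmodType C).
Local Notation N := (NN m n).
Variables (act : int -> 'M[C]_N -> V -> V) (actK actd : V -> V).
Hypothesis hmod : is_hat_g_module act actK actd.
Implicit Types (x y z : 'I_N) (X Y H : 'M[C]_N) (r s : int) (u w : V).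

Definition subspace (W : V -> Prop) : Prop :=
  W 0 /\ forall a u w, W u -> W w -> W (a *: u + w).

Lemma subspaceZ W a u : subspace W -> W u -> W (a *: u).
Proof. by move=> [w0 wl] wu; rewrite -[_ *: _]addr0; apply: wl. Qed.

Lemma subspaceD W u w : subspace W -> W u -> W w -> W (u + w).
Proof. by move=> [w0 wl] wu ww; rewrite -[u]scale1r; apply: wl. Qed.

Lemma subspace_sum W (I : Type) (s : seq I) (f : I -> V) :
  subspace W -> (forall i, W (f i)) -> W (\sum_(i <- s) f i).
Proof.
move=> sW hf; elim: s => [|i s IH]; rewrite ?big_nil ?big_cons; first by case: sW.
exact: subspaceD.
Qed.

Lemma act_lin r X a u w : act r X (a *: u + w) = a *: act r X u + act r X w.
Proof. by case: hmod. Qed.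

Lemma actK_lin a u w : actK (a *: u + w) = a *: actK u + actK w.
Proof. by case: hmod => _ []. Qed.

Lemma actd_lin a u w : actd (a *: u + w) = a *: actd u + actd w.
Proof. by case: hmod => _ [] _ []. Qed.

Lemma act_mxlin r a X Y u : osp X -> osp Y ->
  act r (a *: X + Y) u = a *: act r X u + act r Y u.
Proof. by case: hmod => _ [] _ [] _ [] h _; apply: h. Qed.

Lemma act_bracket r s b1 b2 X Y u : osp_h b1 X -> osp_h b2 Y ->
  act r X (act s Y u) = (-1) ^+ (b1 && b2) *: act s Y (act r X u)
    + (act (r + s) (sbracket b1 b2 X Y) u
       + (if r + s == 0 then r%:~R * gform X Y else 0) *: actK u).
Proof.
case: hmod => _ [] _ [] _ [] _ [] h _ oX oY.
by rewrite -(h _ _ _ _ _ _ _ oX oY) addrC subrK.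
Qed.

Lemma actK_act r X u : osp X -> actK (act r X u) = act r X (actK u).
Proof. by case: hmod => _ [] _ [] _ [] _ [] _ [] h _; apply: h. Qed.

Lemma actd_act r X u : osp X -> actd (act r X u) = act r X (actd u) + r%:~R *: act r X u.
Proof.
case: hmod => _ [] _ [] _ [] _ [] _ [] _ [] h _ oX.
by rewrite -(h _ _ _ oX) addrC subrK.
Qed.

Section LinOp.
Variable (T : V -> V).
Hypothesis T_lin : forall a u w, T (a *: u + w) = a *: T u + T w.

Lemma op0 : T 0 = 0.
Proof. by have := T_lin (-1) 0 0; rewrite scaler0 addr0 scaleN1r addNr. Qed.

Lemma opD u w : T (u + w) = T u + T w.
Proof. by have := T_lin 1 u w; rewrite !scale1r. Qed.

Lemma opZ a u : T (a *: u) = a *: T u.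
Proof. by have := T_lin a u 0; rewrite op0 !addr0. Qed.

Lemma iter_lin k a u w : iter k T (a *: u + w) = a *: iter k T u + iter k T w.
Proof. by elim: k => //= k ->; rewrite T_lin. Qed.
End LinOp.

Lemma act_mx0 r u : act r 0 u = 0.
Proof.
by have := act_mxlin r (-1) u (@osp0 m n) (@osp0 m n); rewrite scaler0 addr0 scaleN1r addNr.
Qed.

Lemma act_mxZ r a X u : osp X -> act r (a *: X) u = a *: act r X u.
Proof. by move=> oX; have := act_mxlin r a u oX (@osp0 m n); rewrite act_mx0 !addr0. Qed.

Lemma act_mxsum r (I : Type) (s : seq I) (c : I -> C) (Y : I -> 'M[C]_N) u :
  (forall i, osp (Y i)) ->
  act r (\sum_(i <- s) c i *: Y i) u = \sum_(i <- s) c i *: act r (Y i) u.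
Proof.
move=> oY; elim: s => [|i s IH]; rewrite ?big_nil ?big_cons.
  exact: act_mx0.
by rewrite act_mxlin ?IH //; apply: osp_sum.
Qed.

Lemma act_expand b r X u : osp_h b X ->
  act r X u = 2^-1 *: \sum_x \sum_y X x y *: act r (ospF x y) u.
Proof.
move=> oX; rewrite {1}(osp_h_expand oX).
under eq_bigr => x _ do rewrite -[\sum_y _]scale1r.
have oF x : osp (\sum_y X x y *: ospF x y) by apply: osp_sum => y; apply: osp_ospF.
rewrite act_mxZ ?act_mxsum //; last exact: osp_sum.
congr (_ *: _); apply: eq_bigr => x _.
by rewrite scale1r act_mxsum // => y; apply: osp_ospF.
Qed.

(** Only pairs in the support of [X] have to be checked, so any homogeneity of [X] is inherited by
    the root vectors in its expansion. *)
Lemma act_osp_ind W r X u : subspace W -> osp X ->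
  (forall x y, X x y != 0 -> W (act r (ospF x y) u)) -> W (act r X u).
Proof.
move=> sW /osp_split[X0 [X1 [-> o0 o1 n0 n1]]] hW.
have key b Y : osp_h b Y -> (forall x y, Y x y != 0 -> (X0 + X1) x y != 0) -> W (act r Y u).
  move=> oY nY; rewrite (act_expand _ _ oY); apply: subspaceZ => //.
  apply: subspace_sum => // x; apply: subspace_sum => // y.
  have [->|/nY nz] := eqVneq (Y x y) 0; first by rewrite scale0r; case: sW.
  by apply: subspaceZ => //; apply: hW.
rewrite -[X0]scale1r act_mxlin; [|exact: osp_of_h o0|exact: osp_of_h o1].
apply: subspaceD => //; last exact: (key _ _ o1).
by apply: subspaceZ => //; apply: (key _ _ o0).
Qed.

(* A pair [(mu, e)] stands for the weight [mu + level Lambda_0 + e delta]. *)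
Definition wtvec (om : 'rV[C]_(m + n) * C) u : Prop :=
  (forall H, cartan H -> act 0 H u = wt_eval om.1 H *: u) /\ actd u = om.2 *: u.

Lemma act_cartan r H X u : cartan H -> osp X ->
  act 0 H (act r X u) = act r X (act 0 H u) + act r (H *m X - X *m H) u.
Proof.
move=> cH [X0 [X1 [-> [o0 o1]]]]; have oH := cartan_osp_h cH.
have key b Y w : osp_h b Y ->
    act 0 H (act r Y w) = act r Y (act 0 H w) + act r (sbracket false b H Y) w.
  move=> oY; rewrite (act_bracket 0 r w oH oY) expr0 scale1r add0r mul0r if_same.
  by rewrite scale0r addr0.
have a r' b b' Y Y' w : osp_h b Y -> osp_h b' Y' ->
    act r' (Y + Y') w = act r' Y w + act r' Y' w.
  move=> oY oY'; rewrite -[Y]scale1r act_mxlin ?scale1r //.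
    exact: osp_of_h oY.
  exact: osp_of_h oY'.
rewrite (a r _ _ _ _ u o0 o1) opD; last by move=> *; apply: act_lin.
rewrite (key _ _ _ o0) (key _ _ _ o1) (a r _ _ _ _ _ o0 o1) addrACA; congr (_ + _).
rewrite -(a r _ _ _ _ u (osp_h_bracket oH o0) (osp_h_bracket oH o1)).
congr (act r _ u); rewrite /sbracket expr0 !scale1r mulmxDl mulmxDr.
by rewrite opprD addrACA.
Qed.

Lemma act_wtvec r X alpha om u : rootsp alpha X -> wtvec om u ->
  wtvec (om.1 + alpha, om.2 + r%:~R) (act r X u).
Proof.
move=> [oX hX] [hu du]; split=> [H cH|] /=.
  rewrite act_cartan // hX // hu // opZ; last by move=> *; apply: act_lin.
  by rewrite act_mxZ // wt_evalD -scalerDl.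
by rewrite actd_act // du (opZ (act_lin r X)) -scalerDl.
Qed.

End Module.

Section Highest.
Variables (m n : nat) (V : lmodType C).
Local Notation N := (NN m n).
Variables (act : int -> 'M[C]_N -> V -> V) (actK actd : V -> V).
Hypothesis hmod : is_hat_g_module act actK actd.
Hypothesis hirr : irreducible act actK actd.
Implicit Types (x y z : 'I_N) (X Y H : 'M[C]_N) (r s : int) (u w : V).
Implicit Types (om : 'rV[C]_(m + n) * C).

Lemma level_scalar (k : C) v : v != 0 -> actK v = k *: v -> forall u, actK u = k *: u.
Proof.
move=> v0 vk; apply: (hirr (W := fun u => actK u = k *: u)); last by exists v.
split=> [|a u w hu hw|r X u oX hu|u hu|u hu].
- by rewrite (op0 (actK_lin hmod)) scaler0.
- by rewrite (actK_lin hmod) hu hw scalerDr !scalerA mulrC.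
- by rewrite (actK_act hmod) // hu (opZ (act_lin hmod r X)).
- by rewrite hu (opZ (actK_lin hmod)) hu.
have [_ [_ [_ [_ [_ [_ [_ Kd]]]]]]] := hmod.
by rewrite Kd hu (opZ (actd_lin hmod)).
Qed.

Variable k : C.
Hypothesis hlevel : forall u, actK u = k *: u.

Inductive gen (Q : int -> 'I_N -> 'I_N -> Prop) (w : V) : V -> Prop :=
| gen_base : gen Q w w
| gen_zero : gen Q w 0
| gen_lin a u1 u2 : gen Q w u1 -> gen Q w u2 -> gen Q w (a *: u1 + u2)
| gen_act r x y u : Q r x y -> gen Q w u -> gen Q w (act r (ospF x y) u).

Lemma gen_subspace Q w : subspace (gen Q w).
Proof. by split=> *; [apply: gen_zero | apply: gen_lin]. Qed.

(* Only the operators outside [Q] must kill [w]: commuting one of them past an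
   element of [Q] leaves the commutator, which the induction covers as well. *)
Lemma gen_all (Q : int -> 'I_N -> 'I_N -> bool) om w :
  wtvec act actd om w -> w != 0 ->
  (forall r x y, ~~ Q r x y -> act r (ospF x y) w = 0) -> forall u, gen Q w u.
Proof.
move=> [_ dw] w0 kill; have sG := gen_subspace Q w.
have genF u : gen Q w u -> forall r x y, gen Q w (act r (ospF x y) u).
  elim=> {u} [r x y|r x y|a u1 u2 _ IH1 _ IH2 r x y|s z t u Qs gu IH r x y].
  - have [q|/kill->] := boolP (Q r x y); last exact: gen_zero.
    by apply: gen_act => //; apply: gen_base.
  - by rewrite (op0 (act_lin hmod _ _)); apply: gen_zero.
  - by rewrite (act_lin hmod); apply: gen_lin.
  rewrite (act_bracket hmod r s u (osp_h_ospF x y) (osp_h_ospF z t)).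
  apply: gen_lin; first exact: gen_act.
  apply: subspaceD => //; last by rewrite hlevel; do 2!apply: subspaceZ => //.
  apply: (act_osp_ind hmod) => //.
  by apply: osp_of_h; apply: osp_h_bracket; apply: osp_h_ospF.
apply: hirr; last by exists w; split=> //; apply: gen_base.
split=> [|a u1 u2|r X u oX gu|u gu|u].
- exact: gen_zero.
- exact: gen_lin.
- by apply: (act_osp_ind hmod) => // x y _; apply: genF.
- by rewrite hlevel; apply: subspaceZ.
elim=> {u} [||a u1 u2 _ IH1 _ IH2|r x y u q gu IH].
- by rewrite dw; apply: subspaceZ => //; apply: gen_base.
- by rewrite (op0 (actd_lin hmod)); apply: gen_zero.
- by rewrite (actd_lin hmod); apply: gen_lin.
rewrite (actd_act hmod); last exact: osp_ospF.
apply: subspaceD => //; first exact: gen_act.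
by apply: subspaceZ => //; apply: gen_act.
Qed.

Inductive wspan : V -> Prop :=
| wspan0 : wspan 0
| wspanD om u1 u2 : wtvec act actd om u1 -> wspan u2 -> wspan (u1 + u2).

Lemma wtvecZ a om u : wtvec act actd om u -> wtvec act actd om (a *: u).
Proof.
move=> [hu du]; split=> [H cH|].
  by rewrite (opZ (act_lin hmod _ _)) hu // !scalerA mulrC.
by rewrite (opZ (actd_lin hmod)) du !scalerA mulrC.
Qed.

(** The weight decomposition of [V]: with every operator allowed in [gen], all of [V] arises from
    one weight vector by root vectors, which shift weights. *)
Lemma wspan_all om w : wtvec act actd om w -> w != 0 -> forall u, wspan u.
Proof.
move=> ww w0 u.
have := gen_all (Q := fun _ _ _ => true) ww w0 (fun r x y => ltac:(by [])) u.
elim=> {u} [||a u1 u2 _ IH1 _ IH2|r x y u _ _ IH].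
- by rewrite -[w]addr0; apply: wspanD ww wspan0.
- exact: wspan0.
- elim: IH1 => [|om1 w1 w2 ww1 _ IH]; first by rewrite scaler0 add0r.
  by rewrite scalerDr -addrA; apply: wspanD IH; apply: wtvecZ ww1.
elim: IH => [|om1 w1 w2 ww1 _ IH].
  by rewrite (op0 (act_lin hmod _ _)); apply: wspan0.
rewrite (opD (act_lin hmod _ _)); apply: wspanD IH.
exact: (act_wtvec hmod r (rootsp_ospF x y) ww1).
Qed.

(** * Eigenvalues occurring in a sum of eigenvectors *)

Section Eigen.
Variables (T : V -> V) (R : C -> Prop).
Hypothesis T_lin : forall a u w, T (a *: u + w) = a *: T u + T w.

(** The summands may vanish or share an eigenvalue. Their number is recorded as the induction
    measure of [eigspan_eigenvalue]. *)
Inductive eigspan : nat -> V -> Prop :=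
| eigspan0 : eigspan 0 0
| eigspanS j l u1 u2 : R l -> T u1 = l *: u1 -> eigspan j u2 -> eigspan j.+1 (u1 + u2).

Lemma eigspanZ a j u : eigspan j u -> eigspan j (a *: u).
Proof.
elim=> {j u} [|j l u1 u2 Rl e _ IH]; first by rewrite scaler0; apply: eigspan0.
rewrite scalerDr; apply: (eigspanS Rl) IH.
by rewrite (opZ T_lin) e !scalerA mulrC.
Qed.

Lemma eigspan_shift c j u : eigspan j u -> eigspan j (T u - c *: u).
Proof.
elim=> {j u} [|j l u1 u2 Rl e _ IH].
  by rewrite (op0 T_lin) scaler0 subrr; apply: eigspan0.
rewrite (opD T_lin) scalerDr opprD addrACA; apply: (eigspanS Rl) IH.
by rewrite e -scalerBl (opZ T_lin) e !scalerA mulrC.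
Qed.

(** Applying T - l1 kills the first summand, of eigenvalue l1, and multiplies [u] by l - l1. If this
    is nonzero, [u] is a multiple of a sum with one summand fewer. *)
Lemma eigspan_eigenvalue j u l : eigspan j u -> u != 0 -> T u = l *: u -> R l.
Proof.
elim: j u => [|j IH] u su.
  by inversion su; rewrite eqxx.
inversion su as [|j' l1 u1 u2 Rl1 e1 s2 ej eu]; subst j' u => u0 e.
have [->//|ll] := eqVneq l l1.
apply: (IH (u1 + u2)) => //.
have -> : u1 + u2 = (l - l1)^-1 *: (T u2 - l1 *: u2); last first.
  exact/eigspanZ/eigspan_shift.
have -> : T u2 - l1 *: u2 = (l - l1) *: (u1 + u2).
  rewrite scalerBl -e (opD T_lin) e1 scalerDr.
  by rewrite opprD addrACA subrr add0r.
by rewrite scalerA mulVf ?scale1r // subr_eq0.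
Qed.

Lemma eigspanD i j u w : eigspan i u -> eigspan j w -> eigspan (i + j) (u + w).
Proof.
move=> su sw; elim: su => {i u} [|i l u1 u2 Rl e _ IH]; first by rewrite add0r.
by rewrite -addrA addSn; apply: eigspanS e IH.
Qed.
End Eigen.

(** * Gradings and the bound on degrees *)

Section Degree.
Variables (psi : 'I_N -> int) (M : int).
Hypothesis psi_dual : forall x, psi (dual x) = - psi x.

Definition hgrade : 'M[C]_N := hdiag (fun x => (psi x)%:~R).

Lemma cartan_hgrade : cartan hgrade.
Proof. by apply: cartan_hdiag => x; rewrite psi_dual rmorphN. Qed.

Definition degw om : C := wt_eval om.1 hgrade + M%:~R * om.2.
(** The grading is inner: this element of the affine Cartan subalgebra acts on root vectors by
    [degF] and on weight vectors by [degw]. *)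
Definition degree u : V := act 0 hgrade u + M%:~R *: actd u.
Definition degF r x y : int := psi x - psi y + r * M.

Lemma degree_lin a u w : degree (a *: u + w) = a *: degree u + degree w.
Proof.
rewrite /degree (act_lin hmod) (actd_lin hmod) !scalerDr addrACA !scalerA.
by rewrite [M%:~R * a]mulrC.
Qed.

Lemma degree_wtvec om u : wtvec act actd om u -> degree u = degw om *: u.
Proof.
move=> [hu du]; rewrite /degree hu ?du ?scalerA -?scalerDl //.
exact: cartan_hgrade.
Qed.

Lemma wt_eval_hgrade x y : wt_eval (wtx x - wtx y) hgrade = (psi x - psi y)%:~R.
Proof.
have cH := cartan_hgrade.
by rewrite wt_evalB !wt_eval_wtx // !hdiagE -rmorphB.
Qed.

Lemma degree_act r x y l u : degree u = l *: u ->
  degree (act r (ospF x y) u) = (l + (degF r x y)%:~R) *: act r (ospF x y) u.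
Proof.
move=> e; have oF := osp_ospF x y; have [_ rF] := rootsp_ospF x y.
have cH := cartan_hgrade.
rewrite /degree (act_cartan hmod) // rF // (actd_act hmod) //.
rewrite (act_mxZ hmod) // wt_eval_hgrade scalerDr addrACA scalerA -scalerDl.
rewrite -(opZ (act_lin hmod _ _)) -(opD (act_lin hmod _ _)).
rewrite -/(degree u) e (opZ (act_lin hmod _ _)) -scalerDl.
by rewrite /degF [in RHS]rmorphD [in RHS]rmorphM [M%:~R * _]mulrC.
Qed.

Definition highest w : Prop :=
  forall r x y, 0 < degF r x y -> act r (ospF x y) w = 0.

(** Operators of positive degree kill [w], so [gen_all] builds [V] from [w] by operators of degree
    at most 0. Every vector is then a sum of eigenvectors of [degree] with eigenvalues below that of
    [w] by natural numbers. *)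
Lemma highest_degree om w om' u : wtvec act actd om w -> w != 0 -> highest w ->
  wtvec act actd om' u -> u != 0 -> exists j : nat, degw om' = degw om - j%:R.
Proof.
move=> ww w0 hw wu u0.
pose R l := exists j : nat, l = degw om - j%:R.
suff [j s] : exists j, eigspan degree R j u.
  exact: (eigspan_eigenvalue degree_lin s u0 (degree_wtvec wu)).
have kill r x y : ~~ (degF r x y <= 0) -> act r (ospF x y) w = 0.
  by rewrite -ltNge; apply: hw.
elim: (gen_all ww w0 kill u) => {u wu u0} [||a u1 u2 _ [j1 s1] _ [j2 s2]|r x y u d _ [j s]].
- exists 1; rewrite -[w]addr0; apply: (eigspanS (l := degw om)).
  + by exists 0; rewrite subr0.
  + exact: degree_wtvec.
  + exact: eigspan0.
- by exists 0; apply: eigspan0.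
- exists (j1 + j2)%N; apply: eigspanD s2; exact: eigspanZ degree_lin _ _ _ s1.
exists j; elim: s => {j u} [|j l u1 u2 [i el] e _ IH].
  by rewrite (op0 (act_lin hmod _ _)); apply: eigspan0.
rewrite (opD (act_lin hmod _ _)); apply: eigspanS (degree_act _ _ _ e) IH.
exists (i + `|degF r x y|)%N; rewrite el natrD opprD addrA; congr (_ + _).
by case: (degF r x y) d => [[|p]|p] // _; rewrite ?oppr0 //= NegzE rmorphN.
Qed.

End Degree.

End Highest.

(** * sl(2)-theory and local nilpotence *)

Section SL2.
Variables (W : zmodType) (V : lmodType C) (P : W -> V -> Prop).

(* [s * cg] is the value of a weight on [[e, f]]; [s] is split off so that [cg]
   is its value on the coroot of [g]. *)
Record sl2_pair (g : W) (s : C) (cg : W -> C) (e f : V -> V) : Prop := Sl2Pair {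
  sl2_s : s != 0;
  sl2_e_lin : forall a u w, e (a *: u + w) = a *: e u + e w;
  sl2_f_lin : forall a u w, f (a *: u + w) = a *: f u + f w;
  sl2_e : forall om u, P om u -> P (om + g) (e u);
  sl2_f : forall om u, P om u -> P (om - g) (f u);
  sl2_c : forall om, cg (om + g) = cg om + 2;
  sl2_comm : forall om u, P om u -> e (f u) - f (e u) = (s * cg om) *: u }.

(** Lets [sl2_top] also be applied towards the lowest vector of a string. *)
Lemma sl2_sym g s cg e f :
  sl2_pair g s cg e f -> sl2_pair (- g) s (fun om => - cg om) f e.
Proof.
case=> s0 el fl he hf hc hcomm; split=> // [om u|om|om u /hcomm h].
- by rewrite opprK; apply: he.
- by have := hc (om - g); rewrite subrK => ->; rewrite opprD subrK.
- by rewrite -opprB h mulrN scaleNr.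
Qed.

Section Pair.
Variables (g : W) (s : C) (cg : W -> C) (e f : V -> V).
Hypothesis ef : sl2_pair g s cg e f.

Lemma sl2_c_sub om j : cg (om - g *+ j) = cg om - 2 * j%:R.
Proof.
elim: j => [|j IH]; first by rewrite mulr0n mulr0 !subr0.
apply: (addIr 2); rewrite -(sl2_c ef) mulrS opprD addrCA [- g + _]addrC subrK.
by rewrite IH -[j.+1%:R]natr1; ring.
Qed.

Lemma sl2_iter_f om u j : P om u -> P (om - g *+ j) (iter j f u).
Proof.
move=> Pu; elim: j => [|j IH]; first by rewrite mulr0n subr0.
by rewrite mulrSr opprD addrA /=; apply: (sl2_f ef).
Qed.

Lemma sl2_e_iter_f om u j : P om u ->
  e (iter j.+1 f u) = (s * (j.+1%:R * (cg om - j%:R))) *: iter j f u + iter j.+1 f (e u).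
Proof.
move=> Pu; elim: j => [|j IH].
  rewrite /= subr0 mul1r -(sl2_comm ef Pu) subrK; done.
have := sl2_comm ef (sl2_iter_f j.+1 Pu) => /eqP; rewrite subr_eq => /eqP ->.
rewrite IH sl2_c_sub (sl2_f_lin ef) -iterS addrA -scalerDl; congr (_ *: _ + _).
by rewrite -[j.+2%:R]natr1; ring.
Qed.

Lemma sl2_primitive om u N : P om u -> u != 0 -> e u = 0 -> iter N f u = 0 ->
  exists2 j : nat, cg om = j%:R & forall i, (i <= j)%N -> iter i f u != 0.
Proof.
move=> Pu u0 eu fN.
have ex : exists N, iter N f u == 0 by exists N; apply/eqP.
case: (ex_minnP ex) => [[|j] /eqP fj min]; first by move: u0; rewrite -fj eqxx.
have nz i : (i <= j)%N -> iter i f u != 0.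
  by move=> ij; apply/negP => /min; rewrite ltnNge ij.
exists j => //; have := sl2_e_iter_f j Pu.
rewrite fj eu (op0 (sl2_e_lin ef)).
have -> : iter j.+1 f 0 = 0 by elim: (j.+1) => //= i ->; rewrite (op0 (sl2_f_lin ef)).
rewrite addr0 => /esym/eqP; rewrite scaler_eq0 (negbTE (nz j (leqnn _))) orbF.
rewrite !mulf_eq0 (negbTE (sl2_s ef)) pnatr_eq0 /= subr_eq0.
by move/eqP.
Qed.

Lemma sl2_iter_f_killed om u j : P om u -> e u = 0 -> cg om = j%:R ->
  e (iter j.+1 f u) = 0.
Proof.
move=> Pu eu cj; rewrite (sl2_e_iter_f j Pu) eu cj subrr !mulr0 scale0r add0r.
by elim: (j.+1) => //= i ->; rewrite (op0 (sl2_f_lin ef)).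
Qed.

(** The last nonzero vector e^q u is primitive with coroot value j = c + 2q, so its first j
    lowerings are nonzero. Lowering it j - q times reaches the weight om - (j - 2q) g = om - c g,
    the reflection of [om]. *)
Lemma sl2_top om u p : P om u -> u != 0 -> iter p e u = 0 ->
  (forall u, exists N, iter N f u = 0) ->
  exists q j : nat, cg om + 2 * q%:R = j%:R /\
    ((q <= j)%N -> exists2 w, P (om + g *+ q - g *+ (j - q)) w & w != 0).
Proof.
move=> Pu u0 ep fnil.
have ex : exists N, iter N e u == 0 by exists p; apply/eqP.
case: (ex_minnP ex) => [[|q] /eqP eq min]; first by move: u0; rewrite -eq eqxx.
have nz : iter q e u != 0 by apply/negP => /min; rewrite ltnn.
have Pq : P (om + g *+ q) (iter q e u).
  elim: (q) => [|i IH]; first by rewrite mulr0n addr0.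
  by rewrite mulrSr addrA /=; apply: (sl2_e ef).
have [N fN] := fnil (iter q e u).
have [j cj nzj] := sl2_primitive Pq nz eq fN.
have cE : cg om + 2 * q%:R = j%:R.
  by rewrite -cj -{1}[om](addrK (g *+ q)) sl2_c_sub subrK.
exists q, j; split=> // qj; exists (iter (j - q) f (iter q e u)); last first.
  by apply: nzj; rewrite leq_subr.
exact: sl2_iter_f.
Qed.
End Pair.

(** The string is followed from its top if q <= j and otherwise from its bottom. *)
Lemma sl2_reflect g s cg e f om u : sl2_pair g s cg e f -> P om u -> u != 0 ->
  (forall u, exists N, iter N f u = 0) -> (forall u, exists N, iter N e u = 0) ->
  exists2 z : int, cg om = z%:~R & exists2 w, P (om - g *~ z) w & w != 0.
Proof.
move=> ef Pu u0 fnil enil.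
have [p ep] := enil u; have [p' fp] := fnil u.
have [q [j [cE h]]] := sl2_top ef Pu u0 ep fnil.
have [q' [j' [cE' h']]] := sl2_top (sl2_sym ef) Pu u0 fp enil.
have [qj|jq] := leqP q j.
  exists (j%:Z - (2 * q)%:Z).
    by rewrite rmorphB /= -!pmulrn -cE natrM addrK.
  have [w Pw w0] := h qj; exists w => //.
  have -> : j%:Z - (2 * q)%:Z = (j - q)%N%:Z - q%:Z by lia.
  by rewrite mulrzBr opprB addrA.
have [qj'|jq'] := leqP q' j'.
  exists ((2 * q')%:Z - j'%:Z).
    by rewrite rmorphB /= -!pmulrn -cE' natrM opprD opprK addrCA subrr addr0.
  have [w Pw w0] := h' qj'; exists w => //.
  have -> : (2 * q')%:Z - j'%:Z = q'%:Z - (j' - q')%N%:Z by lia.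
  rewrite !mulNrn opprK in Pw.
  by rewrite mulrzBr opprB [_ - g *~ q']addrC addrA.
(* Both failures give j + j' < q + q', whereas the coroot values add up to j + j' = 2 (q + q'). *)
have : (j + j')%:R = (2 * (q + q'))%:R :> C.
  by rewrite natrD -cE -cE' natrM natrD; ring.
by move/eqP; rewrite eqr_nat => /eqP; lia.
Qed.
End SL2.

(** * Local nilpotence spreads from one vector to the module *)

Section Nilpotent.
Variables (m n : nat) (V : lmodType C).
Local Notation N := (NN m n).
Variables (act : int -> 'M[C]_N -> V -> V) (actK actd : V -> V).
Hypothesis hmod : is_hat_g_module act actK actd.
Hypothesis hirr : irreducible act actK actd.
Variables (Y : 'M[C]_N) (s : int).
Hypothesis oY : osp_h false Y.
Hypothesis YY : Y *m Y = 0.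
Implicit Types (X : 'M[C]_N) (u w : V).
Let f := act s Y.
Let nil u := exists k, iter k f u = 0.

Let f_lin a u w : f (a *: u + w) = a *: f u + f w.
Proof. exact: act_lin hmod s Y a u w. Qed.

Lemma iter_op0 k : iter k f 0 = 0.
Proof. by elim: k => //= k ->; rewrite (op0 f_lin). Qed.

Lemma nil_subspace : subspace nil.
Proof.
split=> [|a u w [i fi] [j fj]]; first by exists 0.
exists (i + j)%N; rewrite (iter_lin f_lin) [in X in _ + X]iterD fj iter_op0 addr0.
by rewrite addnC iterD fi iter_op0 scaler0.
Qed.

Lemma nil_f u : nil (f u) -> nil u.
Proof. by move=> [i fi]; exists i.+1; rewrite iterSr. Qed.

(** [T1] is the commutator of [f] with [T]. In f (T u) = T (f u) + T1 u the first term is handled by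
    induction on the exponent killing [u], the second by hypothesis. *)
Lemma nil_op (T T1 : V -> V) :
  (forall a u w, T (a *: u + w) = a *: T u + T w) ->
  (forall u, f (T u) = T (f u) + T1 u) -> (forall u, nil u -> nil (T1 u)) ->
  forall u, nil u -> nil (T u).
Proof.
move=> T_lin fT hT1 u [j]; elim: j u => [|i IH] u fi.
  by exists 0; move: fi => /= ->; rewrite (op0 T_lin).
apply: nil_f; rewrite fT; apply: (subspaceD nil_subspace).
  by apply: IH; rewrite -iterSr.
by apply: hT1; exists i.+1.
Qed.

Lemma nil_actK u : nil u -> nil (actK u).
Proof.
apply: (nil_op (actK_lin hmod) (T1 := fun=> 0)) => [w|w _]; last by exists 0.
by rewrite addr0 /f (actK_act hmod) //; apply: osp_of_h oY.
Qed.

Lemma nil_act b X r u : osp_h b X ->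
  (forall w, nil w -> nil (act (s + r) (sbracket false b Y X) w)) ->
  nil u -> nil (act r X u).
Proof.
move=> oX hbr.
apply: (nil_op (act_lin hmod r X)
  (T1 := fun w => act (s + r) (sbracket false b Y X) w
       + (if s + r == 0 then s%:~R * gform Y X else 0) *: actK w)) => [w|w nw].
  by rewrite /f (act_bracket hmod s r w oY oX) scale1r.
apply: (subspaceD nil_subspace); first exact: hbr.
exact/(subspaceZ _ nil_subspace)/nil_actK.
Qed.

(** Since Y Y = 0, the second bracket is -2 Y X Y, and this commutes with Y because both products
    vanish. *)
Lemma bracket3 X :
  sbracket false false Y (sbracket false false Y (sbracket false false Y X)) = 0.
Proof.
have br Z : sbracket false false Y Z = Y *m Z - Z *m Y.
  by rewrite /sbracket scale1r.
have YZ Z : Y *m (Y *m Z) = 0 by rewrite mulmxA YY mul0mx.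
have ZY Z : Z *m Y *m Y = 0 by rewrite -mulmxA YY mulmx0.
set A := Y *m (X *m Y).
have e : sbracket false false Y (sbracket false false Y X) = - A - A.
  rewrite (br X) (br (Y *m X - X *m Y)) mulmxBr mulmxBl YZ ZY sub0r subr0.
  by rewrite -[Y *m X *m Y]mulmxA.
rewrite (br (sbracket false false Y (sbracket false false Y X))) e.
rewrite mulmxBr mulmxBl !mulmxN !mulNmx YZ /A mulmxA ZY.
by rewrite !oppr0 !addr0 subrr.
Qed.

Lemma loc_nilp_all v : v != 0 -> nil v -> forall u, nil u.
Proof.
move=> v0 nv; apply: (hirr (W := nil)); last by exists v.
split.
- by exists 0.
- by case: nil_subspace.
- move=> r X u oX nu; apply: (act_osp_ind hmod nil_subspace oX) => x y _.
  have oF := osp_h_ospF x y.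
  have o1 := osp_h_bracket oY oF; have o2 := osp_h_bracket oY o1.
  (* Each use of [nil_act] replaces the operator by its bracket with [Y]; the third bracket is
     zero. *)
  apply: (nil_act oF) nu => w; apply: (nil_act o1) => {}w; apply: (nil_act o2) => {}w _.
  have -> : sbracket false (false (+) (false (+) (par x (+) par y))) Y
     (sbracket false (false (+) (par x (+) par y)) Y
       (sbracket false (par x (+) par y) Y (ospF x y))) = 0 by exact: bracket3.
  by exists 0; rewrite /= (act_mx0 hmod).
- exact: nil_actK.
move=> u; apply: (nil_op (actd_lin hmod) (T1 := fun w => - s%:~R *: f w)) => [w|w [i fi]].
  by rewrite /f (actd_act hmod) ?scaleNr ?addrK //; apply: osp_of_h oY.
by apply: (subspaceZ _ nil_subspace); exists i; rewrite -iterSr iterS fi (op0 f_lin).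
Qed.

End Nilpotent.

Lemma natC_neq0 j : j.+1%:R != 0 :> C.
Proof. by rewrite pnatr_eq0. Qed.

(** * Root vectors of the affine algebra as sl(2)-pairs *)

Section Pairs.
Variables (m n : nat) (V : lmodType C).
Local Notation N := (NN m n).
Variables (act : int -> 'M[C]_N -> V -> V) (actK actd : V -> V).
Hypothesis hmod : is_hat_g_module act actK actd.
Hypothesis hirr : irreducible act actK actd.
Variable k : C.
Hypothesis hlevel : forall u, actK u = k *: u.
Implicit Types (x y z : 'I_N) (X Y H : 'M[C]_N) (r s : int) (u v w : V).

Definition affW : zmodType := ('rV[C]_(m + n) * C)%type.
Implicit Types (om g : affW).

Definition affroot x y r : affW := (wtx x - wtx y, r%:~R).

(* The value of the weight [om] of level [k] on the coroot of the affine root [g]. *)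
Definition caff g om : C := 2 * (hform om.1 g.1 + g.2 * k) / hform g.1 g.1.

Lemma caffD g om : hform g.1 g.1 != 0 -> caff g (om + g) = caff g om + 2.
Proof. by move=> nz; rewrite /caff hformDl; field. Qed.

Lemma wtvec_raise x y r om u : wtvec act actd om u ->
  wtvec act actd (om + affroot x y r) (act r (ospF x y) u).
Proof. exact: (act_wtvec hmod r (rootsp_ospF x y)). Qed.

Lemma wtvec_lower x y r om u : wtvec act actd om u ->
  wtvec act actd (om - affroot x y r) (act (- r) (ospF y x) u).
Proof.
move=> wu; have := act_wtvec hmod (- r) (rootsp_ospF y x) wu.
by rewrite rmorphN -[wtx y - wtx x]opprB.
Qed.

Lemma ospF_sq x y : x != y -> ospF x y *m ospF x y = 0.
Proof.
move=> xy; have yx : (y == x) = false by rewrite eq_sym (negbTE xy).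
rewrite /ospF mulmxDl !mulmxDr -!scalemxAl -!scalemxAr !mul_delta_mx_cond.
rewrite dual_eq yx (negbTE xy) [y == dual y]eq_sym !dual_neq.
by rewrite !mulr0n !scaler0 !addr0.
Qed.

(** A root vector has two names, (x, y) and (dual y, dual x). This is why exceptional roots are
    always listed below with two alternatives. *)
Lemma ospF_dual x y : ospF (dual y) (dual x) = osp_coef (dual y) (dual x) *: ospF x y.
Proof.
by rewrite /ospF !dualK scalerDr scalerA osp_coef_dual scale1r addrC.
Qed.

Lemma comm_weight b1 b2 x y r om u H : par x (+) par y = b1 ->
  par y (+) par x = b2 ->
  sbracket b1 b2 (ospF x y) (ospF y x) = H -> cartan H -> wtvec act actd om u ->
  act r (ospF x y) (act (- r) (ospF y x) u)
    - (-1) ^+ (b1 && b2) *: act (- r) (ospF y x) (act r (ospF x y) u)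
  = (wt_eval om.1 H + r%:~R * gform (ospF x y) (ospF y x) * k) *: u.
Proof.
move=> <- <- brE cH [hu _].
rewrite (act_bracket hmod r (- r) u (osp_h_ospF x y) (osp_h_ospF y x)).
by rewrite addrC addKr subrr eqxx brE hu // hlevel scalerA -scalerDl.
Qed.

Lemma cartan_lin a H1 H2 : cartan H1 -> cartan H2 -> cartan (a *: H1 + H2).
Proof.
move=> [d1 o1] [d2 o2]; split; last exact: osp_lin.
apply/is_diag_mxP => x y xy; rewrite !mxE.
by move/is_diag_mxP: d1 => ->//; move/is_diag_mxP: d2 => -> //; rewrite mulr0 addr0.
Qed.

Lemma cartan0 : cartan (0 : 'M[C]_N).
Proof. by split; [exact: mx0_is_diag | exact: osp0]. Qed.

Lemma wt_eval_scale mu a H1 H2 :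
  wt_eval mu (a *: H1 + H2) = a * wt_eval mu H1 + wt_eval mu H2.
Proof.
rewrite /wt_eval mulrDr !mulr_sumr addrACA -!big_split /=.
by congr (_ + _); apply: eq_bigr => i _; rewrite !mxE; ring.
Qed.

Lemma hform_long_root x : par x -> hform (wtx x) (wtx x) = 2^-1.
Proof.
elim/index_ind: x => [j|j|i|i]; rewrite ?par_dual ?par_evidx // => _.
  by rewrite wtx_oddidx hform_eps_eps // eqxx mulr1.
by rewrite wtx_dual wtx_oddidx hformNl hformNr opprK hform_eps_eps // eqxx mulr1.
Qed.

Lemma sl2_long x r : par x ->
  sl2_pair (wtvec act actd) (affroot x (dual x) r) 4 (caff (affroot x (dual x) r))
    (act r (ospF x (dual x))) (act (- r) (ospF (dual x) x)).
Proof.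
move=> px.
have hE : hform (wtx x - wtx (dual x)) (wtx x - wtx (dual x)) = 2.
  by rewrite wtx_dual opprK hformDl !hformDr hform_long_root //; field.
split.
- exact: natC_neq0.
- exact: (act_lin hmod).
- exact: (act_lin hmod).
- exact: wtvec_raise.
- exact: wtvec_lower.
- by move=> om; apply: caffD; rewrite hE; exact: natC_neq0.
move=> om u wu.
have c4 : cartan (4 *: coroot x + 0) by apply: cartan_lin; [exact: cartan_coroot|exact: cartan0].
have := comm_weight (b1 := false) (b2 := false) (x := x) (y := dual x) r _ _ _ c4 wu.
rewrite par_dual addbb addr0 bracket_long // => /(_ erefl erefl erefl).
rewrite scale1r => ->; congr (_ *: _).
rewrite gform_long // -[4 *: _]addr0 wt_eval_scale.
rewrite (_ : wt_eval om.1 0 = 0); last first.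
  by have := wt_eval_scale om.1 (-1) 0 0; rewrite scaler0 addr0 mulN1r addNr.
by rewrite wt_eval_coroot px expr1 /caff /= hE wtx_dual !opprK hformDr; field.
Qed.

Lemma sl2_short (i j : 'I_m) (x := oddidx n i) (y := oddidx n j) : i != j ->
  sl2_pair (wtvec act actd) (affroot x y 0) 1 (caff (affroot x y 0))
    (act 0 (ospF x y)) (act (- 0) (ospF y x)).
Proof.
move=> ij; have px : par x := par_oddidx n i; have py : par y := par_oddidx n j.
have hE : hform (wtx x - wtx y) (wtx x - wtx y) = 1.
  rewrite !wtx_oddidx hformBl !hformBr !hform_eps_eps // !eqxx.
  by rewrite [j == i :> nat]eq_sym (negbTE (_ : i != j :> nat)) // mulr1 mulr0; field.
split.
- exact: oner_neq0.
- exact: (act_lin hmod).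
- exact: (act_lin hmod).
- exact: wtvec_raise.
- exact: wtvec_lower.
- by move=> om; apply: caffD; rewrite hE oner_neq0.
move=> om u wu.
have cH : cartan (-1 *: coroot y + coroot x) by apply: cartan_lin; exact: cartan_coroot.
have yx : y != dual x by rewrite oddidx_neq_dual.
have := comm_weight (b1 := false) (b2 := false) (x := x) (y := y) 0 _ _ _ cH wu.
rewrite px py addbb => /(_ erefl erefl); have := bracket_ospF yx.
rewrite px py addbb expr0 scale1r => -> /(_ _).
rewrite scaleN1r addrC scale1r => /(_ erefl) ->; congr (_ *: _).
rewrite mulr0z !mul0r addr0 -[- coroot y]scaleN1r wt_eval_scale !wt_eval_coroot px py.
by rewrite expr1 /caff /= hE hformBr mulr0z; field.
Qed.

(** For an odd root the anticommutator of the two root vectors acts on a weight vector by a multiple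
    of the pairing of its weight with the root, which is zero here. *)
Lemma odd_pair_killed x y r om u : r = 0 -> par x -> par y = false ->
  wtvec act actd om u -> act r (ospF x y) u = 0 ->
  hform om.1 (wtx x - wtx y) = 0 -> act r (ospF x y) (act (- r) (ospF y x) u) = 0.
Proof.
move=> r0 px py wu eu h0; have rz : r%:~R = 0 :> C by rewrite r0.
have cH : cartan (1 *: coroot y + coroot x) by apply: cartan_lin; exact: cartan_coroot.
have yx : y != dual x by apply: contraFneq py => ->; rewrite par_dual.
have := comm_weight (b1 := true) (b2 := true) (x := x) (y := y) r _ _ _ cH wu.
rewrite px py => /(_ erefl erefl); have := bracket_ospF yx.
rewrite px py expr1 => -> /(_ _).
rewrite !scaleN1r !scale1r !opprK addrC => /(_ erefl).
rewrite eu (op0 (act_lin hmod (- r) (ospF y x))) addr0 => ->.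
rewrite rz !mul0r addr0 -[coroot y]scale1r wt_eval_scale !wt_eval_coroot px py.
move: h0; rewrite hformBr => /eqP; rewrite subr_eq0 => /eqP ->.
by rewrite expr1 expr0 (_ : _ + _ = 0) ?scale0r //; ring.
Qed.

Lemma degw_root psi M x y r om : (forall x, psi (dual x) = - psi x) ->
  degw psi M (om - affroot x y r) = degw psi M om - (degF psi M r x y)%:~R.
Proof.
move=> psiD; rewrite /degw /= wt_evalB (wt_eval_hgrade psiD) /degF.
by rewrite [in RHS]rmorphD [in RHS]rmorphM /=; ring.
Qed.

Lemma degw_sub psi M x y r om j : (forall x, psi (dual x) = - psi x) ->
  degw psi M (om - affroot x y r *+ j) = degw psi M om - (degF psi M r x y *+ j)%:~R.
Proof.
move=> psiD; elim: j => [|j IH]; first by rewrite !mulr0n mulr0z !subr0.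
by rewrite !mulrSr [in LHS]opprD addrA degw_root // IH [in RHS]intrD [in RHS]opprD addrA.
Qed.

(** * The submodule argument for a simple root *)

Section Step.
Variables (psi psi' : 'I_N -> int) (M M' : int).
Hypothesis psi_dual : forall x, psi (dual x) = - psi x.
Hypothesis psi'_dual : forall x, psi' (dual x) = - psi' x.
Variables (x0 y0 : 'I_N) (r0 : int).
Hypothesis deg0' : degF psi' M' r0 x0 y0 = 0.
Hypothesis deg0 : 0 < degF psi M r0 x0 y0.
Hypothesis refine : forall r x y, 0 < degF psi M r x y ->
  [\/ 0 < degF psi' M' r x y, ospF x y = 0
   | r = r0 /\ (x = x0 /\ y = y0 \/ x = dual y0 /\ y = dual x0)].

Let f := act (- r0) (ospF y0 x0).

(** In the grading [psi'], [M'] the operator [f] has degree 0, so its bracket with an operator of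
    positive degree again has positive degree. The central term could survive only if the degrees
    summed to zero. *)
Lemma parabolic_stable v : highest act psi' M' v -> highest act psi' M' (f v).
Proof.
move=> hv r x y d; rewrite /f.
rewrite (act_bracket hmod r (- r0) v (osp_h_ospF x y) (osp_h_ospF y0 x0)).
rewrite hv // (op0 (act_lin hmod _ _)) scaler0 add0r.
have hXY := hom_ospF psi'_dual; move: deg0' d; rewrite /degF => e0 d.
have -> : (if r - r0 == 0 then r%:~R * gform (ospF x y) (ospF y0 x0) else 0) *: actK v = 0.
  case: eqP => [/eqP|_]; last by rewrite scale0r.
  rewrite subr_eq0 => /eqP er.
  have [->|gn0] := eqVneq (gform (ospF x y) (ospF y0 x0)) 0; first by rewrite mulr0 scale0r.
  by have := hom_gform (hXY _ _) (hXY _ _) gn0; lia.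
rewrite addr0.
have sK : subspace (fun w => w = 0 :> V).
  by split=> // a u w -> ->; rewrite scaler0 addr0.
apply: (act_osp_ind hmod sK) => [|z t nz].
  by apply: osp_of_h; apply: osp_h_bracket; apply: osp_h_ospF.
apply: hv; have := hom_bracket (hXY x y) (hXY y0 x0) nz; rewrite /degF; lia.
Qed.

(** By [refine], the only root vector to check beyond those of positive [psi']-degree is the raising
    operator of the root itself. It kills [f^(j+1) v] by hypothesis, so if that vector were nonzero
    it would be [highest] for [psi]. *)
Lemma step om v j : wtvec act actd om v -> v != 0 -> highest act psi' M' v ->
  act r0 (ospF x0 y0) (iter j.+1 f v) = 0 -> iter j.+1 f v = 0.
Proof.
move=> wv v0 hv ev; apply/eqP; apply/negPn/negP => nz.
have hj l : highest act psi' M' (iter l f v).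
  by elim: l => //= l IH; apply: parabolic_stable.
have hh : highest act psi M (iter j.+1 f v).
  move=> r x y /refine[d| -> |[-> [[-> ->]|[-> ->]]]].
  - exact: hj.
  - exact: (act_mx0 hmod).
  - exact: ev.
  by rewrite ospF_dual (act_mxZ hmod) ?ev ?scaler0 //; apply: osp_ospF.
have wj i : wtvec act actd (om - affroot x0 y0 r0 *+ i) (iter i f v).
  elim: i => [|i IH]; first by rewrite mulr0n subr0.
  by rewrite mulrSr opprD addrA /=; apply: wtvec_lower.
(* The lowered vector plays the highest vector here and [v] an arbitrary weight vector, but the
   degree of [v] is larger. *)
have [p] := highest_degree hmod hirr hlevel psi_dual (wj j.+1) nz hh wv v0.
rewrite degw_sub // => /eqP.
rewrite -addrA -subr_eq0 opprD addrA subrr sub0r opprD !opprK.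
rewrite [p%:R]pmulrn -rmorphD intr_eq0 => /eqP.
have := deg0; case: (degF _ _ _ _ _) => [d|d] //; rewrite -mulr_natr; nia.
Qed.

End Step.
End Pairs.

(** * Reflections in the real roots of the affine sp(2m) *)

Lemma subr_double (R : comNzRingType) (U : lmodType R) (u : U) : u - 2 *: u = - u.
Proof. by rewrite scaler_nat mulr2n opprD addrA subrr sub0r. Qed.

Lemma reflection_conj (R : comNzRingType) (U : lmodType R) (u a g : U) (x y c : R) :
  u - x *: a - y *: g - (- x - c * y) *: a = u - y *: (g - c *: a).
Proof.
rewrite scalerBl scaleNr -opprD opprK scalerBr scalerA [y * c]mulrC opprB !addrA.
by rewrite [_ - y *: g + _]addrAC subrK addrAC.
Qed.

Section Reflections.
Variables (m n : nat) (k : C) (P : affW m n -> Prop).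
Implicit Types (a g h om : affW m n).

Lemma affN (u : 'rV[C]_(m + n)) (x : C) : - ((u, x) : affW m n) = (- u, - x).
Proof. by []. Qed.

(** Roots have no Lambda_0-component, so the level is fixed by the reflection and enters only
    through [caff]. *)
Definition arefl g om : affW m n :=
  (om.1 - caff k g om *: g.1, om.2 - caff k g om * g.2).

Definition refl_stable g := forall om, P om -> P (arefl g om).

Lemma refl_stableN g : refl_stable g -> refl_stable (- g).
Proof.
move=> Sg om /Sg; congr P; rewrite /arefl /caff /= hformNl !hformNr opprK.
have -> : 2 * (- hform om.1 g.1 + - g.2 * k) / hform g.1 g.1
  = - (2 * (hform om.1 g.1 + g.2 * k) / hform g.1 g.1).
  by rewrite mulNr -opprD mulrN mulNr.
by rewrite scalerN scaleNr opprK mulrNN.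
Qed.

(* The reflection in [s_a g] is [s_a s_g s_a]. *)
Lemma refl_stable_conj a g h (c : C) : hform a.1 a.1 != 0 ->
  c * hform a.1 a.1 = 2 * hform g.1 a.1 ->
  h = (g.1 - c *: a.1, g.2 - c * a.2) ->
  refl_stable a -> refl_stable g -> refl_stable h.
Proof.
move=> a0 cE -> Sa Sg om /Sa/Sg/Sa; congr P; rewrite {1 2}/arefl.
set om1 := arefl a om; set om2 := arefl g om1.
have normE : hform (g.1 - c *: a.1) (g.1 - c *: a.1) = hform g.1 g.1.
  rewrite hformBl !hformBr !hformZl !hformZr [hform a.1 g.1]hformC.
  transitivity (hform g.1 g.1 + c * (c * hform a.1 a.1 - 2 * hform g.1 a.1)); first by ring.
  by rewrite cE subrr mulr0 addr0.
have cg : caff k (g.1 - c *: a.1, g.2 - c * a.2) om = caff k g om1.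
  rewrite {1}/caff /= normE /caff /om1 /arefl /=; congr (_ / _).
  rewrite hformBl !hformBr hformZl !hformZr [hform a.1 g.1]hformC.
  have -> : hform g.1 a.1 = c * hform a.1 a.1 / 2 by rewrite cE; field.
  by rewrite /caff; field.
have ca : caff k a om2 = - caff k a om - c * caff k g om1.
  rewrite {1}/caff /om2 /arefl /= hformBl hformZl.
  rewrite {1}/om1 /arefl /= hformBl hformZl.
  have -> : hform g.1 a.1 = c * hform a.1 a.1 / 2 by rewrite cE; field.
  move: (caff k g om1) => y; rewrite /caff; field; exact: a0.
rewrite /arefl cg ca /om2 /arefl /=; move: (caff k g om1) => y.
by rewrite /om1 /arefl /= reflection_conj; congr pair; ring.
Qed.

Hypothesis m_gt0 : (0 < m)%N.
Local Notation e := (eps m n).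
Hypothesis S_succ : forall i, (i.+1 < m)%N -> refl_stable (e i.+1 - e i, 0).
Hypothesis S_long0 : refl_stable (2 *: e 0, 0).
Hypothesis S_aff : refl_stable (- (2 *: e m.-1), 1).

Let hforme i j (im : (i < m)%N) := hform_eps_eps n j im.

Lemma hform_short i j : (i < m)%N -> (j < m)%N -> i != j ->
  hform (e i - e j) (e i - e j) = 1.
Proof.
move=> im jm ij; rewrite hformBl !hformBr !hforme // !eqxx [j == i]eq_sym (negbTE ij).
by rewrite !mulr1 !mulr0; field.
Qed.

Lemma hform_long i : (i < m)%N -> hform (2 *: e i) (2 *: e i) = 2.
Proof. by move=> im; rewrite hformZl hformZr hforme // eqxx mulr1; field. Qed.

Lemma S_short i j : (i < m)%N -> (j < m)%N -> i != j -> refl_stable (e i - e j, 0).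
Proof.
have lt i' j' : (i' < j')%N -> (j' < m)%N -> refl_stable (e j' - e i', 0).
  elim: j' => // j' IH; rewrite ltnS leq_eqVlt => /orP[/eqP ->|ij] jm; first exact: S_succ.
  have jm' := ltnW jm; have im := ltn_trans ij jm'.
  apply: (refl_stable_conj (a := (e j'.+1 - e j', 0)) (g := (e j' - e i', 0)) (c := -1)).
  - by rewrite hform_short ?oner_neq0 //; lia.
  - rewrite hform_short //; last by lia.
    rewrite /= hformBl !hformBr !hforme // !eqxx.
    have -> : (j' == j'.+1) = false by lia.
    have -> : (i' == j'.+1) = false by lia.
    have -> : (i' == j') = false by lia.
    by rewrite !mulr1 !mulr0; field.
  - rewrite /= mulr0 subr0; congr pair; move: (e j'.+1) (e j') (e i') => x y t.
    by apply/rowP => z; rewrite !mxE; ring.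
  - exact: S_succ.
  - exact: IH.
move=> im jm; rewrite neq_ltn => /orP[ij|ji]; last exact: lt.
by have := refl_stableN (lt _ _ ij jm); rewrite affN opprB oppr0.
Qed.

Lemma S_long i : (i < m)%N -> refl_stable (2 *: e i, 0).
Proof.
case: i => [_|i im]; first exact: S_long0.
apply: (refl_stable_conj (a := (e i.+1 - e 0, 0)) (g := (2 *: e 0, 0)) (c := -2)).
- by rewrite hform_short ?oner_neq0.
- by rewrite hform_short //= hformZl hformBr !hforme // eqxx !mulr0 !mulr1; field.
- rewrite /= mulr0 subr0; congr pair; move: (e _) (e _) => x y.
  by apply/rowP => z; rewrite !mxE; ring.
- exact: S_short.
exact: S_long0.
Qed.

Lemma S_long_aff i : (i < m)%N -> refl_stable (- (2 *: e i), 1).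
Proof.
move=> im; have [->|ne] := eqVneq i m.-1; first exact: S_aff.
have mm : (m.-1 < m)%N by lia.
apply: (refl_stable_conj (a := (e i - e m.-1, 0)) (g := (- (2 *: e m.-1), 1)) (c := 2)).
- by rewrite hform_short ?oner_neq0.
- rewrite hform_short //= hformNl hformZl hformBr !hforme // eqxx.
  by rewrite [m.-1 == i]eq_sym (negbTE ne) !mulr0 !mulr1; field.
- rewrite /= mulr0 subr0; congr pair; move: (e _) (e _) => x y.
  by apply/rowP => z; rewrite !mxE; ring.
- exact: S_short.
exact: S_aff.
Qed.

(** Up to the sign of the root, the reflection in (2 e_i, 0) replaces r by -r, and conjugating (2
    e_i, -r) by the reflection in (2 e_i, 1) gives r + 2. Hence r = 0 and r = 1 lead to every r. *)
Lemma S_long_all i (r : int) : (i < m)%N -> refl_stable (2 *: e i, r%:~R).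
Proof.
move=> im; have l0 : hform (2 *: e i) (2 *: e i) != 0 by rewrite hform_long ?pnatr_eq0.
have Sneg i' : (i' < m)%N -> refl_stable (2 *: e i', -1).
  by move=> im'; have := refl_stableN (S_long_aff im'); rewrite affN opprK.
have neg r1 : refl_stable (2 *: e i, r1) -> refl_stable (2 *: e i, - r1).
  move=> S1; suff : refl_stable (- (2 *: e i, - r1)) by move/refl_stableN; rewrite opprK.
  apply: (refl_stable_conj (a := (2 *: e i, 0)) (g := (2 *: e i, r1)) (c := 2)) => //.
  - by rewrite affN opprK /= mulr0 subr0 subr_double.
  - exact: S_long.
have shift r1 : refl_stable (2 *: e i, r1) -> refl_stable (2 *: e i, r1 + 2).
  move=> /neg S1; suff : refl_stable (- (2 *: e i, r1 + 2)) by move/refl_stableN; rewrite opprK.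
  have Sa : refl_stable (2 *: e i, 1) by have := neg _ (Sneg _ im); rewrite opprK.
  apply: (refl_stable_conj (a := (2 *: e i, 1)) (g := (2 *: e i, - r1)) (c := 2)) => //.
  rewrite affN /= subr_double.
  by congr pair; ring.
have pos j : refl_stable (2 *: e i, j%:R) /\ refl_stable (2 *: e i, j.+1%:R).
  elim: j => [|j [IH1 IH2]]; first split; first exact: S_long.
    by have := neg _ (Sneg _ im); rewrite opprK.
  split=> //; have := shift _ IH1; congr (refl_stable (_, _)).
  by rewrite -!natr1; ring.
case: r => j; first by case: (pos j).
by rewrite NegzE rmorphN; apply: neg; case: (pos j).
Qed.

(** The delta-part of a short root comes from a long one: reflecting e_i - e_j in 2 e_i + r delta
    gives -(e_i + e_j) - r delta. *)
Lemma S_sum i j (r : int) : (i < m)%N -> (j < m)%N -> i != j ->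
  refl_stable (e i + e j, r%:~R).
Proof.
move=> im jm ij.
suff : refl_stable (- (e i + e j, r%:~R)) by move/refl_stableN; rewrite opprK.
apply: (refl_stable_conj (a := (2 *: e i, r%:~R)) (g := (e i - e j, 0)) (c := 1)).
- by rewrite /= hform_long ?pnatr_eq0.
- rewrite /= hform_long // hformZr hformBl !hforme // eqxx.
  by rewrite [j == i]eq_sym (negbTE ij) !mulr0 !mulr1; field.
- rewrite /= scale1r mul1r sub0r; congr pair; move: (e i) (e j) => x y.
  by apply/rowP => z; rewrite !mxE; ring.
- exact: S_long_all.
exact: S_short.
Qed.

Lemma S_diff i j (r : int) : (i < m)%N -> (j < m)%N -> i != j ->
  refl_stable (e i - e j, r%:~R).
Proof.
move=> im jm ij.
apply: (refl_stable_conj (a := (2 *: e j, 0)) (g := (e i + e j, r%:~R)) (c := 1)).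
- by rewrite /= hform_long ?pnatr_eq0.
- by rewrite /= hform_long // hformZr hformDl !hforme // eqxx (negbTE ij) !mulr0 !mulr1; field.
- rewrite /= mulr0 subr0 scale1r; congr pair; move: (e i) (e j) => x y.
  by apply/rowP => z; rewrite !mxE; ring.
- exact: S_long.
exact: S_sum.
Qed.

Lemma refl_stable_D0sharp alpha (r : int) : D0sharp alpha -> refl_stable (alpha, r%:~R).
Proof.
have opp beta : refl_stable (beta, (- r)%:~R) -> refl_stable (- beta, r%:~R).
  by move=> /refl_stableN; rewrite affN rmorphN opprK.
case=> [[i [j [im jm ij [->|->|->]]]]|[i [im [->|->]]]].
- exact: S_diff.
- exact: S_sum.
- by apply: opp; apply: S_sum.
- exact: S_long_all.
- by apply: opp; apply: S_long_all.
Qed.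

Lemma D0sharp_hform_neq0 (alpha : 'rV[C]_(m + n)) : D0sharp alpha -> hform alpha alpha != 0.
Proof.
have sumE i j : (i < m)%N -> (j < m)%N -> i != j -> hform (e i + e j) (e i + e j) = 1.
  move=> im jm ij; rewrite hformDl !hformDr !hforme // !eqxx [j == i]eq_sym (negbTE ij).
  by rewrite !mulr1 !mulr0; field.
case=> [[i [j [im jm ij [->|->|->]]]]|[i [im [->|->]]]].
- by rewrite hform_short ?oner_neq0.
- by rewrite sumE ?oner_neq0.
- by rewrite hformNl hformNr opprK sumE ?oner_neq0.
- by rewrite hform_long ?pnatr_eq0.
- by rewrite hformNl hformNr opprK hform_long ?pnatr_eq0.
Qed.

End Reflections.

(** * Gradings replacing the Borel subalgebras *)

Section Gradings.
Variables m n : nat.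
Local Notation N := (NN m n).
Implicit Types (x y : 'I_N) (r M : int) (p q : nat -> int).

(* An index is determined by its parity [par], the sign [xneg] of its weight and
   the number [xnum] of the basis vector; in this form comparisons of degrees are
   linear arithmetic. *)
Definition xneg x : bool := (n <= x < n + n)%N || (n + n + m <= x)%N.
Definition xnum x : nat :=
  if (x < n)%N then x : nat else if (x < n + n)%N then (x - n)%N
  else if (x < n + n + m)%N then (x - (n + n))%N else (x - (n + n + m))%N.

Lemma sval_code p q x : sval p q x =
  let t := if par x then p (xnum x) else q (xnum x) in if xneg x then - t else t.
Proof.
rewrite /sval /xneg /xnum /par.
have [x1|x1] := ltnP x n.
  have -> : (n + n <= x)%N = false by lia.
  by have -> : (n + n + m <= x)%N = false by lia.
have [x2|x2] := ltnP x (n + n).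
  by have -> : (n + n + m <= x)%N = false by lia.
by have [x3|x3] := ltnP x (n + n + m).
Qed.

Lemma code_inj x y : par x = par y -> xneg x = xneg y -> xnum x = xnum y -> x = y.
Proof.
rewrite /par /xneg /xnum => h1 h2 h3; apply/val_inj => /=.
have := index_bound x; have := index_bound y; move: h1 h2 h3.
by do ?[case: ifP => ?]; lia.
Qed.

Lemma xnum_bound x : (xnum x < if par x then m else n)%N.
Proof.
have := index_bound x; rewrite /xnum /par; do ?[case: ifP => ?]; lia.
Qed.

Lemma xneg_dual x : xneg (dual x) = ~~ xneg x.
Proof.
have := index_bound x; rewrite /xneg /= /dual_nat; do ?[case: ifP => ?]; lia.
Qed.

Lemma xnum_dual x : xnum (dual x) = xnum x.
Proof.
have := index_bound x; rewrite /xnum /= /dual_nat.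
case: (ltnP x n) => ?; first by (do ?[case: ifP => ?]; lia).
case: (ltnP x (n + n)) => ?; first by (do ?[case: ifP => ?]; lia).
by case: (ltnP x (n + n + m)) => ?; do ?[case: ifP => ?]; lia.
Qed.

Lemma xneg_evidx (j : 'I_n) : xneg (evidx m j) = false.
Proof. by rewrite /xneg /=; have := ltn_ord j; lia. Qed.

Lemma xneg_oddidx (i : 'I_m) : xneg (oddidx n i) = false.
Proof. by rewrite /xneg /=; have := ltn_ord i; lia. Qed.

Lemma xnum_evidx (j : 'I_n) : xnum (evidx m j) = j.
Proof. by rewrite /xnum /=; have := ltn_ord j; do ?[case: ifP => ?]; lia. Qed.

Lemma xnum_oddidx (i : 'I_m) : xnum (oddidx n i) = i.
Proof. by rewrite /xnum /=; have := ltn_ord i; do ?[case: ifP => ?]; lia. Qed.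

Definition codeE := (par_dual, xneg_dual, xnum_dual, xneg_evidx, xneg_oddidx,
  xnum_evidx, xnum_oddidx, par_evidx, par_oddidx).

(** Removes the product of two variables: after the split, [r * M] is generalised and the
    comparisons of degrees become linear. *)
Lemma level_cases r M : 0 <= M ->
  [\/ r = 0 /\ r * M = 0, r = 1 /\ r * M = M, 2 <= r /\ 2 * M <= r * M
   | r <= -1 /\ r * M <= - M].
Proof.
move=> M0; have [r0|r0] := leP r (-1); first by constructor 4; split=> //; nia.
have [r2|r2] := leP 2 r; first by constructor 3; split=> //; nia.
have [->|r1] := eqVneq r 0; first by constructor 1; rewrite mul0r.
have e : r = 1 by lia.
by constructor 2; rewrite e mul1r.
Qed.

(* The basic grading: [eps i] has degree [4 i + 2], [del j] has degree [4 j] and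
   [delta] has degree [8 m], so that all simple roots have positive degree; the
   gaps leave room for the modified gradings of the odd reflections. *)
Definition pdeg (i : nat) : int := (4 * i + 2)%N.
Definition qdeg (j : nat) : int := (4 * j)%N.
Definition upd (f : nat -> int) (b : nat) (v : nat) (i : nat) : int :=
  if i == b then v%:Z else f i.
Local Notation psi0 := (sval pdeg qdeg).
Local Notation M0 := (8 * m)%:Z.

Hypothesis nm : (n <= m)%N.

Ltac grade r x y :=
  let hx := fresh "hx" in let hy := fresh "hy" in let hr := fresh "hr" in
  have hx := xnum_bound x; have hy := xnum_bound y;
  rewrite /degF !sval_code /upd /pdeg /qdeg;
  move: hx hy; move: (xnum x) (xnum y) (par x) (par y) (xneg x) (xneg y);
  do 2 intro; do 4 case => /=; (do ?[case: eqP => ?]); lia.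

Definition code (c s : bool) (i : nat) x : bool := [&& par x == c, xneg x == s & xnum x == i].

Lemma codeP c s i x y : code c s i x -> par y = c -> xneg y = s -> xnum y = i -> x = y.
Proof. by move=> /and3P[/eqP <- /eqP <- /eqP <-] *; apply: code_inj. Qed.

Section Short.
Variable b : nat.
Hypothesis bm : (b.+1 < m)%N.
Local Notation psi1 := (sval (upd pdeg b.+1 (4 * b + 2)) qdeg).
Let bad r x y := (r == 0) && (code true false b.+1 x && code true false b y
  || code true true b x && code true true b.+1 y).

(** When n <= b + 1 there is no [del b.+1], and eps (b+1) - eps b is simple from the start. Lowering
    [eps b.+1] to the degree of [eps b] gives this root degree 0; by [tail_refine] no other positive
    root is lost. *)
Lemma tail_coarse r x y : (n <= b.+1)%N ->
  0 < degF psi1 M0 r x y -> 0 < degF psi0 M0 r x y.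
Proof.
move=> nb; have [] := @level_cases r M0 isT => -[_].
all: rewrite /degF; move: (r * M0) => t ht; grade r x y.
Qed.

Lemma tail_refine r x y : (n <= b.+1)%N ->
  0 < degF psi0 M0 r x y -> (0 < degF psi1 M0 r x y) || bad r x y.
Proof.
move=> nb; have [] := @level_cases r M0 isT => -[hr].
all: rewrite /bad /code /degF; move: (r * M0) => t ht; grade r x y.
Qed.

Local Notation psi2 := (sval (upd pdeg b.+1 (4 * b + 3)) qdeg).

(** [psi2] puts [eps b.+1] at 4b + 3, between [eps b] at 4b + 2 and [del b.+1] at 4b + 4: this is
    the odd reflection in [beta b.+1]. The new positive root is its opposite, under its two
    names. *)
Lemma inner_coarse r x y : (b.+1 < n)%N -> 0 < degF psi2 M0 r x y ->
  (0 < degF psi0 M0 r x y) || (r == 0) &&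
    (code false false b.+1 x && code true false b.+1 y
     || code true true b.+1 x && code false true b.+1 y).
Proof.
move=> nb; have [] := @level_cases r M0 isT => -[hr].
all: rewrite /code /degF; move: (r * M0) => t ht; grade r x y.
Qed.

Lemma inner_coarse2 r x y : (b.+1 < n)%N ->
  0 < degF psi1 M0 r x y -> 0 < degF psi2 M0 r x y.
Proof.
move=> nb; have [] := @level_cases r M0 isT => -[hr].
all: rewrite /degF; move: (r * M0) => t ht; grade r x y.
Qed.

Lemma inner_refine r x y : (b.+1 < n)%N ->
  0 < degF psi2 M0 r x y -> (0 < degF psi1 M0 r x y) || bad r x y.
Proof.
move=> nb; have [] := @level_cases r M0 isT => -[hr].
all: rewrite /bad /code /degF; move: (r * M0) => t ht; grade r x y.
Qed.
End Short.

Section Odd.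
Variable b : nat.
Hypothesis bn : (b < n)%N.
Local Notation psi1 := (sval (upd pdeg b (4 * b + 1)) (upd qdeg b (4 * b + 1))).

(** The pairs of weight difference plus or minus 2 [del i], which is no root: [ospF] vanishes on
    them. They must be allowed for because [del 0] has degree 0 in the basic grading and positive
    degree in modified ones. *)
Definition del2 x y : bool := [&& ~~ par x, ~~ par y, xneg x != xneg y & xnum x == xnum y].

Lemma odd_coarse r x y : 0 < degF psi1 M0 r x y ->
  (0 < degF psi0 M0 r x y) || del2 x y.
Proof.
have [] := @level_cases r M0 isT => -[hr].
all: rewrite /del2 /degF; move: (r * M0) => t ht; grade r x y.
Qed.

Lemma odd_refine r x y : 0 < degF psi0 M0 r x y ->
  (0 < degF psi1 M0 r x y) || (r == 0) &&
    (code true false b x && code false false b y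
     || code false true b x && code true true b y).
Proof.
have [] := @level_cases r M0 isT => -[hr].
all: rewrite /code /degF; move: (r * M0) => t ht; grade r x y.
Qed.
End Odd.

Section Long.
Hypothesis n_gt0 : (0 < n)%N.
Local Notation psi1 := (sval (upd pdeg 0 0) (upd qdeg 0 2)).
Local Notation psi2 := (sval (upd pdeg 0 1) (upd qdeg 0 2)).

(** [psi2] has [eps 0] at 1 below [del 0] at 2, the odd reflection in [beta 0]; now [2 *: eps 0] is
    simple, and [psi1] gives it degree 0. *)
Lemma long_coarse r x y : 0 < degF psi2 M0 r x y ->
  [|| 0 < degF psi0 M0 r x y, del2 x y | (r == 0) &&
    (code false false 0 x && code true false 0 y
     || code true true 0 x && code false true 0 y)].
Proof.
have [] := @level_cases r M0 isT => -[hr].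
all: rewrite /code /del2 /degF; move: (r * M0) => t ht; grade r x y.
Qed.

Lemma long_coarse2 r x y : 0 < degF psi1 M0 r x y -> 0 < degF psi2 M0 r x y.
Proof.
have [] := @level_cases r M0 isT => -[hr].
all: rewrite /degF; move: (r * M0) => t ht; grade r x y.
Qed.

Lemma long_refine r x y : 0 < degF psi2 M0 r x y ->
  (0 < degF psi1 M0 r x y) || (r == 0) && (code true false 0 x && code true true 0 y).
Proof.
have [] := @level_cases r M0 isT => -[hr].
all: rewrite /code /degF; move: (r * M0) => t ht; grade r x y.
Qed.

Local Notation M1 := ((8 * m)%:Z - 4).

(** [M1] is twice the degree of [eps m.-1], so it gives delta - 2 [eps m.-1] degree 0. This root is
    simple already, and only the degree of delta is changed. *)
Lemma affine_coarse r x y : 0 < degF psi0 M1 r x y -> 0 < degF psi0 M0 r x y.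
Proof.
have M1_ge0 : 0 <= M1 by lia.
have [] := @level_cases r M0 isT => -[hr]; have [] := level_cases r M1_ge0 => -[hr'].
all: rewrite /degF; move: (r * M0) (r * M1) => t t' ht' ht; grade r x y.
Qed.

Lemma affine_refine r x y : 0 < degF psi0 M0 r x y ->
  (0 < degF psi0 M1 r x y) || (r == 1) && (code true true m.-1 x && code true false m.-1 y).
Proof.
have M1_ge0 : 0 <= M1 by lia.
have [] := @level_cases r M0 isT => -[hr]; have [] := level_cases r M1_ge0 => -[hr'].
all: rewrite /code /degF; move: (r * M0) (r * M1) => t t' ht' ht; grade r x y.
Qed.
End Long.

Lemma ospF_del2 x y : del2 x y -> ospF x y = 0.
Proof.
move=> /and4P[px py /eqP s /eqP i].
have -> : y = dual x; last exact: ospF_evdual.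
apply: code_inj; rewrite !codeE ?(negbTE px) ?(negbTE py) //.
by case: (xneg x) (xneg y) s => [] [].
Qed.

End Gradings.

(** * Positive degree versus sums of simple roots *)

Section Positive.
Variables m n : nat.
Hypotheses (n_gt0 : (0 < n)%N) (nm : (n <= m)%N).
Local Notation e := (eps m n).
Local Notation d := (del m n).
Implicit Types (al be : 'rV[C]_(m + n)).

Lemma sum_pick (V : lmodType C) (s : seq nat) (i : nat) (f : nat -> V) : uniq s -> i \in s ->
  \sum_(j <- s) (j == i)%:R *: f j = f i.
Proof.
move=> us si; rewrite (bigD1_seq i) //= eqxx scale1r big1_seq ?addr0 // => j /andP[ji _].
by rewrite (negbTE ji) scale0r.
Qed.

Lemma sum_pick_ord (V : lmodType C) (l i : nat) (f : nat -> V) : (i < l)%N ->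
  \sum_(j < l) (j == i :> nat)%:R *: f j = f i.
Proof.
move=> il; rewrite -(big_mkord xpredT (fun j => (j == i)%:R *: f j)).
by rewrite sum_pick ?iota_uniq // mem_index_iota.
Qed.

Lemma sum_none (V : lmodType C) (I : Type) (s : seq I) (f : I -> V) :
  \sum_(j <- s) 0%:R *: f j = 0.
Proof. by rewrite big1 // => j _; rewrite scale0r. Qed.

Lemma sum_natD (V : lmodType C) (I : Type) (s : seq I) (a b : I -> nat) (f : I -> V) :
  \sum_(j <- s) (a j + b j)%:R *: f j = \sum_(j <- s) (a j)%:R *: f j + \sum_(j <- s) (b j)%:R *: f j.
Proof. by rewrite -big_split; apply: eq_bigr => j _; rewrite natrD scalerDl. Qed.

Lemma poscombD al be : poscomb al -> poscomb be -> poscomb (al + be).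
Proof.
move=> [a [b [c [k ->]]]] [a' [b' [c' [k' ->]]]].
exists (fun i => a i + a' i)%N, (fun i => b i + b' i)%N, (fun i => c i + c' i)%N, (k + k')%N.
rewrite !sum_natD natrD scalerDl /= addrACA; congr (_ + _).
by rewrite addrACA; congr (_ + _); rewrite addrACA.
Qed.

Let zero := fun _ : nat => 0%N.

Lemma poscomb0 : poscomb (0 : 'rV[C]_(m + n)).
Proof. by exists zero, zero, zero, 0%N; rewrite !sum_none scale0r !addr0. Qed.

Lemma poscomb_eps_succ j : (n.-1 <= j)%N -> (j < m.-1)%N -> poscomb (e j.+1 - e j).
Proof.
move=> nj jm; exists (fun i => (i == j) : nat), zero, zero, 0%N.
by rewrite !sum_none scale0r !addr0 (sum_pick (fun j => e j.+1 - e j)) ?iota_uniq // mem_index_iota nj.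
Qed.

Lemma poscomb_eps_del j : (j < n)%N -> poscomb (e j - d j).
Proof.
move=> jn; exists zero, (fun i => (i == j) : nat), zero, 0%N.
by rewrite !sum_none scale0r !addr0 add0r (sum_pick_ord (fun j => e j - d j)).
Qed.

Lemma poscomb_del_eps j : (j.+1 < n)%N -> poscomb (d j.+1 - e j).
Proof.
move=> jn; exists zero, zero, (fun i => (i == j) : nat), 0%N.
rewrite !sum_none scale0r !addr0 !add0r (sum_pick_ord (fun j => d j.+1 - e j)) //; lia.
Qed.

Lemma poscomb_eps_del0 : poscomb (e 0 + d 0).
Proof. by exists zero, zero, zero, 1%N; rewrite !sum_none scale1r !add0r. Qed.

Lemma poscomb_trans al be ga : poscomb (al - be) -> poscomb (be - ga) -> poscomb (al - ga).
Proof. by move=> h /(poscombD h); rewrite addrA subrK. Qed.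

(** A step from e_j to e_(j+1) is a simple root in the tail and passes through d_(j+1) when j + 1 <
    n. *)
Lemma poscomb_ee i j : (i <= j)%N -> (j < m)%N -> poscomb (e j - e i).
Proof.
elim: j => [|j IH]; first by rewrite leqn0 => /eqP -> _; rewrite subrr; apply: poscomb0.
rewrite leq_eqVlt => /orP[/eqP -> _|ij jm]; first by rewrite subrr; apply: poscomb0.
apply: (@poscomb_trans _ (e j)); last by apply: IH => //; apply: ltnW.
have [jn|jn] := ltnP j.+1 n; last by apply: poscomb_eps_succ; lia.
apply: (@poscomb_trans _ (d j.+1)); first exact: poscomb_eps_del.
exact: poscomb_del_eps.
Qed.

Lemma poscomb_ed i j : (j <= i)%N -> (i < m)%N -> (j < n)%N -> poscomb (e i - d j).
Proof.
move=> ji im jn; apply: (@poscomb_trans _ (e j)); first exact: poscomb_ee.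
exact: poscomb_eps_del.
Qed.

Lemma poscomb_de i j : (i < j)%N -> (j < n)%N -> poscomb (d j - e i).
Proof.
case: j => // j ij jn; apply: (@poscomb_trans _ (e j)); first exact: poscomb_del_eps.
by apply: poscomb_ee => //; lia.
Qed.

Lemma poscomb_dd i j : (i <= j)%N -> (j < n)%N -> poscomb (d j - d i).
Proof.
rewrite leq_eqVlt => /orP[/eqP -> _|ij jn]; first by rewrite subrr; apply: poscomb0.
apply: (@poscomb_trans _ (e i)); first exact: poscomb_de.
by apply: poscomb_eps_del; lia.
Qed.

Lemma poscomb_e_plus i : (i < m)%N -> poscomb (e i + d 0).
Proof.
move=> im; rewrite -[d 0]opprK; apply: (@poscomb_trans _ (e 0)); first exact: poscomb_ee.
by rewrite opprK; apply: poscomb_eps_del0.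
Qed.

Lemma poscomb_sum al j : poscomb (al + d 0) -> poscomb (d j - d 0) -> poscomb (al + d j).
Proof. by move=> h /(poscombD h); rewrite addrA addrAC addrK. Qed.

Local Notation N := (NN m n).
Local Notation psi0 := (sval pdeg qdeg).
Local Notation M0 := (8 * m)%:Z.
Implicit Types (x y : 'I_N).

Lemma index_sign x : exists u : 'I_N,
  ((exists i : 'I_m, u = oddidx n i) \/ (exists j : 'I_n, u = evidx m j)) /\
  (x = u \/ x = dual u).
Proof.
elim/index_ind: x => [j|j|i|i].
- by exists (evidx m j); split; [right; exists j|left].
- by exists (evidx m j); split; [right; exists j|right].
- by exists (oddidx n i); split; [left; exists i|left].
- by exists (oddidx n i); split; [left; exists i|right].
Qed.

(** Needed to translate the condition of [hw_vector] on sums of simple roots into [highest]. *)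
Lemma poscomb_wtx x y : 0 < psi0 x - psi0 y -> poscomb (wtx x - wtx y).
Proof.
have [u [ku xu]] := index_sign x; have [v [kv yv]] := index_sign y.
have diff u1 v1 : ((exists i : 'I_m, u1 = oddidx n i) \/ (exists j : 'I_n, u1 = evidx m j)) ->
    ((exists i : 'I_m, v1 = oddidx n i) \/ (exists j : 'I_n, v1 = evidx m j)) ->
    0 < psi0 u1 - psi0 v1 -> poscomb (wtx u1 - wtx v1).
  case=> [[i ->]|[i ->]] [[j ->]|[j ->]];
    rewrite ?sval_oddidx ?sval_evidx ?wtx_oddidx ?wtx_evidx /pdeg /qdeg => h.
  - by apply: poscomb_ee => //; lia.
  - by apply: poscomb_ed => //; lia.
  - by apply: poscomb_de => //; lia.
  - by apply: poscomb_dd => //; lia.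
have sum : 0 < psi0 u + psi0 v -> poscomb (wtx u + wtx v).
  case: ku => [[i ->]|[i ->]]; case: kv => [[j ->]|[j ->]];
    rewrite ?sval_oddidx ?sval_evidx ?wtx_oddidx ?wtx_evidx /pdeg /qdeg => h.
  (* e_i + e_j = (e_i + d_0) + (e_j - d_0). *)
  - have := poscombD (poscomb_e_plus (ltn_ord i)) (poscomb_ed (leq0n j) (ltn_ord j) n_gt0).
    by rewrite addrACA subrr addr0.
  - by apply: poscomb_sum; [exact: poscomb_e_plus|apply: poscomb_dd].
  - rewrite addrC.
    by apply: poscomb_sum; [exact: poscomb_e_plus|apply: poscomb_dd].
  (* d_i + d_0 = (d_i - e_0) + (e_0 + d_0) requires a positive index; positivity of the degree
     excludes that both indices are 0. *)
  have [i0|i0] := posnP i.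
    rewrite addrC i0.
    have j0 : (0 < j)%N by lia.
    have := poscombD (poscomb_de j0 (ltn_ord j)) poscomb_eps_del0.
    by rewrite addrA subrK.
  have := poscombD (poscomb_de i0 (ltn_ord i)) poscomb_eps_del0.
  rewrite addrA subrK => h1; apply: poscomb_sum => //; exact: poscomb_dd.
have nonneg u1 : ((exists i : 'I_m, u1 = oddidx n i) \/ (exists j : 'I_n, u1 = evidx m j)) ->
    0 <= psi0 u1.
  by case=> [[i ->]|[i ->]]; rewrite ?sval_oddidx ?sval_evidx.
have nu := nonneg _ ku; have nv := nonneg _ kv.
case: xu => ->; case: yv => -> .
- exact: diff.
- by rewrite sval_dual wtx_dual !opprK; apply: sum.
- by rewrite sval_dual; lia.
- rewrite !sval_dual !wtx_dual !opprK => h; rewrite addrC; apply: diff => //; lia.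
Qed.

Local Notation H0 := (hgrade psi0).

Lemma psi0_dual x : psi0 (dual x) = - psi0 x.
Proof. exact: sval_dual. Qed.

Lemma wt_eps i : (i < m)%N -> wt_eval (e i) H0 = (4 * i + 2)%:R.
Proof.
by move=> im; rewrite (wt_eval_eps (Ordinal im)) hdiagE sval_oddidx.
Qed.

Lemma wt_del j : (j < n)%N -> wt_eval (d j) H0 = (4 * j)%:R.
Proof.
by move=> jn; rewrite (wt_eval_del (Ordinal jn)) hdiagE sval_evidx.
Qed.

Lemma poscomb_degree al : poscomb al -> exists l : nat, wt_eval al H0 = l%:R.
Proof.
pose Q al := exists l : nat, wt_eval al H0 = l%:R.
have QD al1 al2 : Q al1 -> Q al2 -> Q (al1 + al2).
  by move=> [l1 h1] [l2 h2]; exists (l1 + l2)%N; rewrite wt_evalD h1 h2 natrD.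
have QZ a al1 : Q al1 -> Q (a%:R *: al1).
  by move=> [l1 h1]; exists (a * l1)%N; rewrite wt_evalZ h1 natrM.
have Q0 : Q 0 by exists 0%N; rewrite wt_eval0.
have Qsub i j al1 al2 : wt_eval al1 H0 = i%:R -> wt_eval al2 H0 = j%:R -> (j <= i)%N ->
    Q (al1 - al2).
  by move=> h1 h2 ji; exists (i - j)%N; rewrite wt_evalB h1 h2 natrB.
move=> [a [b [c [k ->]]]]; apply: (QD); last first.
  by apply: (QZ); apply: (QD); [exists 2%N; rewrite wt_eps //; lia|exists 0%N; rewrite wt_del].
apply: (QD); last first.
  elim/big_ind: _ => // j _; apply: (QZ); have := ltn_ord j => jn.
  by apply: (Qsub (4 * j.+1)%N (4 * j + 2)%N); rewrite ?wt_eps ?wt_del //; lia.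
apply: (QD).
  rewrite big_nat; elim/big_ind: _ => // j /andP[j1 j2]; apply: (QZ).
  by apply: (Qsub (4 * j.+1 + 2)%N (4 * j + 2)%N); rewrite ?wt_eps //; lia.
elim/big_ind: _ => // j _; apply: (QZ); have := ltn_ord j => jn.
by apply: (Qsub (4 * j + 2)%N (4 * j)%N); rewrite ?wt_eps ?wt_del //; lia.
Qed.

(** The bound 8m is the degree of delta, so [al] + r delta has positive degree for every r > 0. *)
Lemma D0sharp_degree al : D0sharp al -> exists z : int,
  [/\ wt_eval al H0 = z%:~R, z != 0, - (8 * m)%:Z < z & z < (8 * m)%:Z].
Proof.
case=> [[i [j [im jm ij [->|->|->]]]]|[i [im [->|->]]]].
- exists ((4 * i + 2)%:Z - (4 * j + 2)%:Z); rewrite wt_evalB !wt_eps // rmorphB.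
  by split=> //; lia.
- exists ((4 * i + 2)%:Z + (4 * j + 2)%:Z); rewrite wt_evalD !wt_eps // intrD.
  by split=> //; lia.
- exists (- ((4 * i + 2)%:Z + (4 * j + 2)%:Z)); rewrite wt_evalN wt_evalD !wt_eps // [in RHS]mulrNz intrD.
  by split=> //; lia.
- exists (2 * (4 * i + 2)%:Z); rewrite wt_evalZ wt_eps // intrM.
  by split=> //; lia.
- exists (- (2 * (4 * i + 2)%:Z)); rewrite wt_evalN wt_evalZ wt_eps // [in RHS]mulrNz intrM.
  by split=> //; lia.
Qed.

Lemma hw_highest (V : lmodType C) (act : int -> 'M[C]_N -> V -> V) (actK actd : V -> V)
    (Lam : affwt m n) v : hw_vector act actK actd Lam v -> highest act psi0 M0 v.
Proof.
move=> [_ [_ [_ [_ [kill_pos kill0]]]]] r x y; rewrite /degF.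
have bound (z : 'I_N) : - (4 * m)%:Z < psi0 z /\ psi0 z < (4 * m)%:Z.
  by elim/index_ind: z => j; rewrite ?sval_dual ?sval_oddidx ?sval_evidx /pdeg /qdeg;
    have := ltn_ord j; split; lia.
have [x1 x2] := bound x; have [y1 y2] := bound y.
case: r => [[|r]|r].
- rewrite mul0r addr0 => h; apply: (kill0 (wtx x - wtx y)); first exact: poscomb_wtx.
    apply: contraTneq h => h; have := wt_eval_hgrade psi0_dual x y.
    by rewrite h wt_eval0 => /esym/eqP; rewrite intr_eq0 => /eqP ->.
  exact: rootsp_ospF.
- by move=> _; apply: kill_pos => //; apply: osp_ospF.
- by rewrite NegzE => h; exfalso; nia.
Qed.

End Positive.

Section Codes.
Variables m n : nat.
Implicit Types (x y : 'I_(NN m n)).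

Lemma code_eq c s i x y : code c s i x -> code c s i y -> x = y.
Proof. by move=> hx /and3P[/eqP py /eqP sy /eqP ny]; apply: codeP hx _ _ _. Qed.

Lemma code_dual c s i x : code c s i x -> code c (~~ s) i (dual x).
Proof.
move=> /and3P[/eqP <- /eqP <- /eqP <-].
by rewrite /code !codeE !eqxx.
Qed.

Lemma code_oddidx (i : 'I_m) : code true false i (oddidx n i).
Proof. by rewrite /code !codeE !eqxx. Qed.

Lemma code_evidx (j : 'I_n) : code false false j (evidx m j).
Proof. by rewrite /code !codeE !eqxx. Qed.

Lemma codes_pair c s i c' s' i' x0 y0 x y : code c s i x0 -> code c' s' i' y0 ->
  code c s i x && code c' s' i' y || code c' (~~ s') i' x && code c (~~ s) i y ->
  x = x0 /\ y = y0 \/ x = dual y0 /\ y = dual x0.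
Proof.
move=> h h' /orP[/andP[k k']|/andP[k k']]; [left|right].
  by split; [exact: code_eq k h|exact: code_eq k' h'].
by split; [apply: code_eq k (code_dual h')|apply: code_eq k' (code_dual h)].
Qed.
End Codes.

(** * Lowering operators of simple roots on the highest weight vector *)

Section HighestWeight.
Variables (m n : nat) (V : lmodType C).
Hypotheses (n_gt0 : (0 < n)%N) (nm : (n <= m)%N).
Local Notation N := (NN m n).
Variables (act : int -> 'M[C]_N -> V -> V) (actK actd : V -> V).
Hypothesis hmod : is_hat_g_module act actK actd.
Hypothesis hirr : irreducible act actK actd.
Variable k : C.
Hypothesis hlevel : forall u, actK u = k *: u.
Variables (om : affW m n) (v : V).
Hypotheses (wv : wtvec act actd om v) (v0 : v != 0).
Local Notation psi0 := (sval pdeg qdeg).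
Local Notation M0 := (8 * m)%:Z.
Hypothesis hv : highest act psi0 M0 v.
Hypothesis hbeta : forall i, (i < n)%N -> hform om.1 (beta m n i) = 0.
Implicit Types (x y : 'I_N).

Let svalD (p q : nat -> int) x : sval p q (dual x) = - sval p q x := sval_dual p q x.

Lemma act_ospF_pair r x0 y0 x y u : x = x0 /\ y = y0 \/ x = dual y0 /\ y = dual x0 ->
  act r (ospF x0 y0) u = 0 -> act r (ospF x y) u = 0.
Proof.
case=> [[-> ->]//|[-> ->]] e0.
by rewrite ospF_dual (act_mxZ hmod) ?e0 ?scaler0 //; apply: osp_ospF.
Qed.

Lemma act_ospF0 r x y u : ospF x y = 0 -> act r (ospF x y) u = 0.
Proof. by move=> ->; apply: (act_mx0 hmod). Qed.

Lemma beta_lowering_kills (b : 'I_n) (i : 'I_m) : i = b :> nat ->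
  act (- 0) (ospF (evidx m b) (oddidx n i)) v = 0.
Proof.
move=> ib; have bn := ltn_ord b.
(* [eps b] and [del b], at 4b + 2 and 4b, are both moved to the midpoint, which gives [beta b]
   degree 0. *)
pose psi1 : 'I_N -> int := sval (upd pdeg b (4 * b + 1)) (upd qdeg b (4 * b + 1)).
have h1 : highest act psi1 M0 v.
  move=> r x y /(odd_coarse nm bn)/orP[/hv//|/ospF_del2 F0].
  exact: act_ospF0.
have ci := code_oddidx n i; have cb := code_evidx m b; rewrite ib in ci.
have deg0' : degF psi1 M0 0 (oddidx n i) (evidx m b) = 0.
  by rewrite /degF /psi1 sval_oddidx sval_evidx /upd ib eqxx subrr mul0r addr0.
have deg0 : 0 < degF psi0 M0 0 (oddidx n i) (evidx m b).
  by rewrite /degF sval_oddidx sval_evidx /pdeg /qdeg ib mul0r; lia.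
apply: (step hmod hirr hlevel (svalD _ _) (svalD _ _) deg0' deg0 _ (j := 0) wv v0 h1).
  move=> r x y /(odd_refine nm bn)/orP[d|/andP[/eqP -> cc]]; first by constructor 1.
  by constructor 3; split=> //; apply: codes_pair ci cb cc.
have h0 : hform om.1 (wtx (oddidx n i) - wtx (evidx m b)) = 0.
  by rewrite wtx_oddidx wtx_evidx ib; apply: hbeta.
exact: (odd_pair_killed hmod hlevel erefl (par_oddidx n i) (par_evidx m b) wv (hv deg0) h0).
Qed.

Lemma beta_lowering_pair (b : nat) r x y : (b < n)%N -> (r == 0) &&
  (code false false b x && code true false b y || code true true b x && code false true b y) ->
  act r (ospF x y) v = 0.
Proof.
move=> bn /andP[/eqP -> cc]; have bm := leq_trans bn nm.
apply: (act_ospF_pair _ (@beta_lowering_kills (Ordinal bn) (Ordinal bm) erefl)).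
exact: codes_pair (code_evidx m (Ordinal bn)) (code_oddidx n (Ordinal bm)) cc.
Qed.

Section Simple.
Variables (x0 y0 : 'I_N) (r0 : int) (s : C).
Local Notation g := (affroot x0 y0 r0).
Local Notation e := (act r0 (ospF x0 y0)).
Local Notation f := (act (- r0) (ospF y0 x0)).
Hypothesis ef : sl2_pair (wtvec act actd) g s (caff k g) e f.
Hypothesis deg0 : 0 < degF psi0 M0 r0 x0 y0.

Lemma simple_primitive : (exists i, iter i f v = 0) -> exists j : nat, caff k g om = j%:R.
Proof.
move=> [i fi]; have [j cj _] := sl2_primitive ef wv v0 (hv deg0) fi.
by exists j.
Qed.

Lemma simple_nilpotent psi M psi' M' j :
  (forall x, psi (dual x) = - psi x) -> (forall x, psi' (dual x) = - psi' x) ->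
  degF psi' M' r0 x0 y0 = 0 -> 0 < degF psi M r0 x0 y0 -> highest act psi' M' v ->
  (forall r x y, 0 < degF psi M r x y -> 0 < degF psi' M' r x y \/
     (r = r0 /\ (x = x0 /\ y = y0 \/ x = dual y0 /\ y = dual x0))) ->
  caff k g om = j%:R -> iter j.+1 f v = 0.
Proof.
move=> psiD psi'D d' d h' ref cj.
apply: (step hmod hirr hlevel psiD psi'D d' d _ wv v0 h') => [r x y /ref[]|].
- by constructor 1.
- by constructor 3.
exact: (sl2_iter_f_killed ef wv (hv deg0) cj).
Qed.
End Simple.

Lemma short_nilpotent b (bm : (b.+1 < m)%N) j
    (x := oddidx n (Ordinal bm)) (y := oddidx n (Ordinal (ltnW bm))) :
  caff k (affroot x y 0) om = j%:R -> iter j.+1 (act (- 0) (ospF y x)) v = 0.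
Proof.
have ne : Ordinal bm != Ordinal (ltnW bm) by rewrite -val_eqE /= gtn_eqF.
have ef := sl2_short hmod hlevel ne; rewrite -/x -/y in ef.
have cx : code true false b.+1 x := code_oddidx n (Ordinal bm).
have cy : code true false b y := code_oddidx n (Ordinal (ltnW bm)).
have deg0 : 0 < degF psi0 M0 0 x y.
  by rewrite /degF !sval_oddidx /pdeg /= mul0r; lia.
have deg0' : degF (sval (upd pdeg b.+1 (4 * b + 2)) qdeg) M0 0 x y = 0.
  rewrite /degF !sval_oddidx /upd /pdeg /= eqxx mul0r.
  have -> : (b == b.+1) = false by lia.
  lia.
(* Either the root is simple in the given Borel subalgebra, or it is the sum of [beta b.+1] and
   [del b.+1 - eps b], and the Borel subalgebra reflected in [beta b.+1] is used. *)
have [bn|bn] := leqP n b.+1.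
  apply: (simple_nilpotent ef deg0 (svalD _ _) (svalD _ _) deg0' deg0).
    by move=> r z t /(tail_coarse nm bm bn)/hv.
  move=> r z t /(tail_refine nm bm bn)/orP[d|/andP[/eqP -> cc]]; [by left|right].
  by split=> //; apply: codes_pair cx cy cc.
have deg1 : 0 < degF (sval (upd pdeg b.+1 (4 * b + 3)) qdeg) M0 0 x y.
  rewrite /degF !sval_oddidx /upd /pdeg /= eqxx mul0r.
  have -> : (b == b.+1) = false by lia.
  lia.
apply: (simple_nilpotent ef deg0 (svalD _ _) (svalD _ _) deg0' deg1).
  move=> r z t /(inner_coarse2 nm bm bn)/(inner_coarse nm bm bn)/orP[/hv//|].
  exact: beta_lowering_pair.
move=> r z t /(inner_refine nm bm bn)/orP[d|/andP[/eqP -> cc]]; [by left|right].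
by split=> //; apply: codes_pair cx cy cc.
Qed.

Lemma long_nilpotent (i : 'I_m) j (x := oddidx n i) : i = 0%N :> nat ->
  caff k (affroot x (dual x) 0) om = j%:R ->
  iter j.+1 (act (- 0) (ospF (dual x) x)) v = 0.
Proof.
move=> i0; have ef := sl2_long hmod hlevel 0 (par_oddidx n i); rewrite -/x in ef.
have cx := code_oddidx n i; have cy := code_dual cx; rewrite -/x i0 /= in cx cy.
have deg0 : 0 < degF psi0 M0 0 x (dual x).
  by rewrite /degF svalD sval_oddidx /pdeg /= mul0r; lia.
have deg0' : degF (sval (upd pdeg 0 0) (upd qdeg 0 2)) M0 0 x (dual x) = 0.
  by rewrite /degF svalD sval_oddidx /upd i0.
have deg1 : 0 < degF (sval (upd pdeg 0 1) (upd qdeg 0 2)) M0 0 x (dual x).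
  by rewrite /degF svalD sval_oddidx /upd i0 /= mul0r.
apply: (simple_nilpotent ef deg0 (svalD _ _) (svalD _ _) deg0' deg1).
  move=> r z t /(long_coarse2 nm n_gt0)/(long_coarse nm n_gt0)/or3P[/hv//|/ospF_del2 F0|].
    exact: act_ospF0.
  exact: beta_lowering_pair.
move=> r z t /(long_refine nm n_gt0)/orP[d|/and3P[/eqP -> c1 c2]]; [by left|right].
by split=> //; left; split; [exact: code_eq c1 cx|exact: code_eq c2 cy].
Qed.

Lemma affine_nilpotent (i : 'I_m) j (x := dual (oddidx n i)) : i = m.-1 :> nat ->
  caff k (affroot x (dual x) 1) om = j%:R ->
  iter j.+1 (act (- 1) (ospF (dual x) x)) v = 0.
Proof.
move=> im; have px : par x by rewrite par_dual par_oddidx.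
have ef := sl2_long hmod hlevel 1 px.
have cx := code_dual (code_oddidx n i); have cy := code_dual cx; rewrite -/x im /= in cx cy.
have m_gt0 : (0 < m)%N by apply: leq_trans n_gt0 nm.
have xE (p q : nat -> int) : sval p q x - sval p q (dual x) = - (p i *+ 2).
  by rewrite /x !svalD sval_oddidx opprK -opprD mulr2n.
have deg0 : 0 < degF psi0 M0 1 x (dual x).
  by rewrite /degF xE /pdeg im mul1r; lia.
have deg0' : degF psi0 ((8 * m)%:Z - 4) 1 x (dual x) = 0.
  by rewrite /degF xE /pdeg im mul1r; lia.
apply: (simple_nilpotent ef deg0 (svalD _ _) (svalD _ _) deg0' deg0).
  by move=> r z t /(affine_coarse nm n_gt0)/hv.
move=> r z t /(affine_refine nm n_gt0)/orP[d|/and3P[/eqP -> c1 c2]]; [by left|right].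
by split=> //; left; split; [exact: code_eq c1 cx|exact: code_eq c2 cy].
Qed.

End HighestWeight.

(** * Integrability *)

Section Integrability.
Variables (m n : nat) (V : lmodType C).
Hypotheses (n_gt0 : (0 < n)%N) (nm : (n <= m)%N).
Local Notation N := (NN m n).
Variables (act : int -> 'M[C]_N -> V -> V) (actK actd : V -> V).
Hypothesis hmod : is_hat_g_module act actK actd.
Hypothesis hirr : irreducible act actK actd.
Variable k : C.
Hypothesis hlevel : forall u, actK u = k *: u.
Variables (om : affW m n) (v : V).
Hypotheses (wv : wtvec act actd om v) (v0 : v != 0).
Local Notation psi0 := (sval pdeg qdeg).
Local Notation M0 := (8 * m)%:Z.
Hypothesis hv : highest act psi0 M0 v.
Hypothesis hbeta : forall i, (i < n)%N -> hform om.1 (beta m n i) = 0.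
Implicit Types (x y : 'I_N) (al : 'rV[C]_(m + n)).
Local Notation e := (eps m n).

Let m_gt0 : (0 < m)%N := leq_trans n_gt0 nm.

Lemma affMn (g : affW m n) j : g *+ j = (g.1 *+ j, g.2 *+ j).
Proof. by elim: j => [|j IH]; rewrite ?mulr0n // !mulrS IH. Qed.

Lemma affMz (g : affW m n) (z : int) : g *~ z = (g.1 *~ z, g.2 *~ z).
Proof. by case: z => j; rewrite ?NegzE ?mulrNz -!pmulrn affMn. Qed.

Definition is_weight (om' : affW m n) : Prop := exists2 u, wtvec act actd om' u & u != 0.

Lemma simple_refl x y r s : par x = par y -> x != y ->
  sl2_pair (wtvec act actd) (affroot x y r) s (caff k (affroot x y r))
    (act r (ospF x y)) (act (- r) (ospF y x)) ->
  act r (ospF x y) v = 0 -> (exists i, iter i (act (- r) (ospF y x)) v = 0) ->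
  refl_stable k is_weight (wtx x - wtx y, r%:~R).
Proof.
move=> pxy xy ef ev fv om' [u wu u0].
have oF (z t : 'I_N) : par z = par t -> osp_h false (ospF z t).
  by move=> pzt; have := osp_h_ospF z t; rewrite pzt addbb.
have yx : y != x by rewrite eq_sym.
have fnil := loc_nilp_all hmod hirr (oF _ _ (esym pxy)) (ospF_sq yx) v0 fv.
(* The raising operator is locally nilpotent for the same reason, as its first power kills [v]. *)
have enil := loc_nilp_all hmod hirr (oF _ _ pxy) (ospF_sq xy) v0 (ex_intro _ 1%N ev).
have [z cz [w ww w0]] := sl2_reflect ef wu u0 fnil enil.
exists w => //; move: ww; congr (wtvec _ _ _ w).
by rewrite affMz /arefl -/(affroot x y r) cz scaler_int mulrzl.
Qed.

Lemma weight_degree om' : is_weight om' ->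
  exists j : nat, degw psi0 M0 om' = degw psi0 M0 om - j%:R.
Proof. by move=> [u wu u0]; apply: (highest_degree hmod hirr hlevel (@psi0_dual m n) wv v0 hv wu u0). Qed.

Lemma degw_shift om' al (c : C) (r z : int) : wt_eval al (hgrade psi0) = z%:~R ->
  degw psi0 M0 ((om'.1 - c *: al, om'.2 - c * r%:~R) : affW m n)
  = degw psi0 M0 om' - c * (z + r * M0)%:~R.
Proof.
move=> hz; rewrite /degw /= wt_evalB wt_evalZ hz intrD intrM; ring.
Qed.

(** No commutation relation of [X] is used, only weights: if c is the coroot value of mu, the
    reflection sends mu - i gamma to mu - (c - i) gamma, whose degree grows by deg gamma > 0 with
    each i. *)
Lemma reflect_loc_nilp al (r : nat) (z : int) : D0sharp al ->
  wt_eval al (hgrade psi0) = z%:~R -> 0 < z + r%:Z * M0 ->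
  refl_stable k is_weight (al, (r%:Z)%:~R) -> loc_nilp act al r.
Proof.
move=> dal hz zpos refl X rX u.
have lin := act_lin hmod (- r%:Z) X.
have iter0 i : iter i (act (- r%:Z) X) 0 = 0.
  by elim: i => //= i ->; rewrite (op0 lin).
elim: (wspan_all hmod hirr hlevel wv v0 u) => {u} [|om' u1 u2 wu1 _ [i2 h2]].
  by exists 0%N.
suff [i1 h1] : exists i, iter i (act (- r%:Z) X) u1 = 0.
  exists (i1 + i2)%N; rewrite -[u1]scale1r (iter_lin lin) [in X in _ + X]iterD h2 iter0.
  by rewrite addnC iterD h1 iter0 scaler0 addr0.
have [->|u0] := eqVneq u1 0; first by exists 0%N.
pose g : affW m n := (al, (r%:Z)%:~R).
have a0 : hform g.1 g.1 != 0 := D0sharp_hform_neq0 dal.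
have wi i : wtvec act actd (om' - g *+ i) (iter i (act (- r%:Z) X) u1).
  elim: i => [|i IH]; first by rewrite mulr0n subr0.
  have := act_wtvec hmod (- r%:Z) rX IH.
  by rewrite mulrSr opprD addrA /= rmorphN.
have ci i : caff k g (om' - g *+ i) = caff k g om' - 2 * i%:R.
  elim: i => [|i IH]; first by rewrite mulr0n mulr0 !subr0.
  apply: (addIr 2); rewrite -caffD // mulrSr opprD addrA subrK IH -[i.+1%:R]natr1; ring.
have [j0 d0] := weight_degree (ex_intro2 _ _ u1 wu1 u0).
have main i : iter i (act (- r%:Z) X) u1 != 0 -> exists j : nat,
    degw psi0 M0 om' - (caff k g om' - i%:R) * (z + r%:Z * M0)%:~R = degw psi0 M0 om - j%:R.
  move=> nz; have := refl _ (ex_intro2 _ _ _ (wi i) nz) => /weight_degree[j]; rewrite /arefl.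
  have := degw_shift (om' - g *+ i) (caff k g (om' - g *+ i)) r%:Z hz.
  move=> -> ej; exists j; rewrite -ej ci.
  have -> : degw psi0 M0 (om' - g *+ i) = degw psi0 M0 om' - i%:R * (z + r%:Z * M0)%:~R.
    rewrite -(degw_shift om' _ _ hz); congr degw.
    by rewrite affMn scaler_nat mulr_natl.
  ring.
(* The reflection of mu itself lies j1 below the top degree. After j1 + 1 applications of [X] the
   reflected weight is higher by at least j1 + 1, hence above the top. *)
have [j1 h1] := main 0%N u0.
have [h|nz] := eqVneq (iter j1.+1 (act (- r%:Z) X) u1) 0; first by exists j1.+1.
have [j2 h2'] := main _ nz; exfalso.
have : (j1%:Z - j2%:Z)%:~R = (j1.+1%:Z * (z + r%:Z * M0))%:~R :> C.
  rewrite rmorphB rmorphM /= -!pmulrn.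
  transitivity ((degw psi0 M0 om - j2%:R) - (degw psi0 M0 om - j1%:R)); first by ring.
  by rewrite -h1 -h2'; ring.
move/intr_inj; nia.
Qed.

Lemma caff_short b (bm : (b.+1 < m)%N) :
  caff k (affroot (oddidx n (Ordinal bm)) (oddidx n (Ordinal (ltnW bm))) 0) om
  = 2 * hform om.1 (e b.+1) - 2 * hform om.1 (e b).
Proof.
rewrite /caff /affroot !wtx_oddidx /= (hform_short n bm (ltnW bm)); last by lia.
by rewrite hformBr mulr0z; field.
Qed.

Lemma caff_long (i : 'I_m) : i = 0%N :> nat ->
  caff k (affroot (oddidx n i) (dual (oddidx n i)) 0) om = 2 * hform om.1 (e 0).
Proof.
move=> i0; rewrite /caff /affroot wtx_dual wtx_oddidx opprK i0 /=.
have -> : e 0 + e 0 = 2 *: e 0 by rewrite scaler_nat mulr2n.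
by rewrite hform_long // hformZr mulr0z; field.
Qed.

Lemma caff_affine (i : 'I_m) : i = m.-1 :> nat ->
  caff k (affroot (dual (oddidx n i)) (dual (dual (oddidx n i))) 1) om
  = k - 2 * hform om.1 (e m.-1).
Proof.
move=> im; rewrite /caff /affroot !wtx_dual wtx_oddidx opprK im /=.
have mm : (m.-1 < m)%N by lia.
have -> : - e m.-1 - e m.-1 = - (2 *: e m.-1) by rewrite scaler_nat mulr2n opprD.
by rewrite !hformNr hformNl opprK hform_long // hformZr mulr1z; field.
Qed.

Lemma D0sharp_succ b : (b.+1 < m)%N -> D0sharp (e b.+1 - e b).
Proof. by move=> bm; left; exists b.+1, b; split=> //; [exact: ltnW|lia|constructor 1]. Qed.

Lemma degF_short b (bm : (b.+1 < m)%N) :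
  0 < degF psi0 M0 0 (oddidx n (Ordinal bm)) (oddidx n (Ordinal (ltnW bm))).
Proof. by rewrite /degF !sval_oddidx /pdeg /= mul0r; lia. Qed.

Lemma degF_long (i : 'I_m) : 0 < degF psi0 M0 0 (oddidx n i) (dual (oddidx n i)).
Proof. by rewrite /degF sval_dual sval_oddidx /pdeg /= mul0r; lia. Qed.

Lemma degF_affine (i : 'I_m) :
  0 < degF psi0 M0 1 (dual (oddidx n i)) (dual (dual (oddidx n i))).
Proof. by rewrite /degF !sval_dual sval_oddidx /pdeg /= mul1r; have := ltn_ord i; lia. Qed.

Lemma integrable_necessary : integrable act ->
  [/\ exists j : nat, 2 * hform om.1 (e 0) = j%:R,
      forall b, (b.+1 < m)%N -> exists j : nat, 2 * hform om.1 (e b.+1) - 2 * hform om.1 (e b) = j%:R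
    & exists j : nat, k - 2 * hform om.1 (e m.-1) = j%:R].
Proof.
move=> [int0 intr].
have mm : (m.-1 < m)%N by lia.
split.
- pose i0 := Ordinal m_gt0; pose x := oddidx n i0.
  have [j cj] : exists j : nat, caff k (affroot x (dual x) 0) om = j%:R.
    apply: (simple_primitive wv v0 hv (sl2_long hmod hlevel 0 (par_oddidx n i0)) (degF_long i0)).
    apply: (int0 (2 *: e 0)).
    + by right; exists 0%N; split=> //; left.
    + have := poscombD (poscomb_eps_del m n_gt0) (poscomb_eps_del0 m n).
      by rewrite addrACA addNr addr0 scaler_nat mulr2n.
    have := rootsp_ospF (dual x) x; rewrite wtx_dual wtx_oddidx /=.
    by rewrite scaler_nat mulr2n opprD.
  by exists j; rewrite -cj caff_long.
- move=> b bm; have ne : Ordinal bm != Ordinal (ltnW bm) by rewrite -val_eqE /= gtn_eqF.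
  pose x := oddidx n (Ordinal bm); pose y := oddidx n (Ordinal (ltnW bm)).
  have [j cj] : exists j : nat, caff k (affroot x y 0) om = j%:R.
    apply: (simple_primitive wv v0 hv (sl2_short hmod hlevel ne) (degF_short bm)).
    apply: (int0 (e b.+1 - e b)); first exact: D0sharp_succ.
      by apply: poscomb_ee.
    by have := rootsp_ospF y x; rewrite !wtx_oddidx opprB.
  by exists j; rewrite -cj caff_short.
pose i1 := Ordinal mm; pose x := dual (oddidx n i1).
have px : par x by rewrite par_dual par_oddidx.
have [j cj] : exists j : nat, caff k (affroot x (dual x) 1) om = j%:R.
  apply: (simple_primitive wv v0 hv (sl2_long hmod hlevel 1 px) (degF_affine i1)).
  apply: (intr (- (2 *: e m.-1)) 1%N) => //.
    by right; exists m.-1; split=> //; right.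
  have := rootsp_ospF (dual x) x; rewrite !wtx_dual wtx_oddidx /= !opprK.
  by rewrite scaler_nat mulr2n.
by exists j; rewrite -cj caff_affine.
Qed.

Lemma integrable_sufficient :
  (exists j : nat, 2 * hform om.1 (e 0) = j%:R) ->
  (forall b, (b.+1 < m)%N -> exists j : nat, 2 * hform om.1 (e b.+1) - 2 * hform om.1 (e b) = j%:R) ->
  (exists j : nat, k - 2 * hform om.1 (e m.-1) = j%:R) -> integrable act.
Proof.
move=> [j0 h0] hs [jk hk]; have mm : (m.-1 < m)%N by lia.
have S_succ b : (b.+1 < m)%N -> refl_stable k is_weight (e b.+1 - e b, 0).
  move=> bm; have ne : Ordinal bm != Ordinal (ltnW bm) by rewrite -val_eqE /= gtn_eqF.
  have [j hj] := hs b bm; rewrite -(caff_short bm) in hj.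
  have := simple_refl _ _ (sl2_short hmod hlevel ne) (hv (degF_short bm)).
  rewrite !par_oddidx !wtx_oddidx /= mulr0z; apply=> //.
    by apply: contra ne => /eqP/(congr1 (@xnum m n)); rewrite !xnum_oddidx => h; apply/eqP/val_inj.
  by exists j.+1; apply: (short_nilpotent n_gt0 nm hmod hirr hlevel wv v0 hv hbeta hj).
have S_long0 : refl_stable k is_weight (2 *: e 0, 0).
  pose i0 := Ordinal m_gt0.
  have hj := h0; rewrite -(@caff_long i0 erefl) in hj.
  have := simple_refl _ _ (sl2_long hmod hlevel 0 (par_oddidx n i0)) (hv (degF_long i0)).
  rewrite par_dual wtx_dual wtx_oddidx opprK /= mulr0z scaler_nat mulr2n; apply=> //.
    by rewrite eq_sym dual_neq.
  by exists j0.+1; apply: (long_nilpotent n_gt0 nm hmod hirr hlevel wv v0 hv hbeta _ hj).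
have S_aff : refl_stable k is_weight (- (2 *: e m.-1), 1).
  pose i1 := Ordinal mm.
  have hj := hk; rewrite -(@caff_affine i1 erefl) in hj.
  have px : par (dual (oddidx n i1)) by rewrite par_dual par_oddidx.
  have := simple_refl _ _ (sl2_long hmod hlevel 1 px) (hv (degF_affine i1)).
  rewrite !par_dual !wtx_dual wtx_oddidx opprK /= mulr1z scaler_nat mulr2n opprD; apply=> //.
    by rewrite eq_sym dual_neq.
  by exists jk.+1; apply: (affine_nilpotent n_gt0 nm hmod hirr hlevel wv v0 hv _ hj).
have S_all al (r : int) : D0sharp al -> refl_stable k is_weight (al, r%:~R).
  exact: refl_stable_D0sharp.
(* Positivity of the degree of the root: for r = 0 it is nonzero and a sum of simple roots has
   natural degree; for r > 0 it follows from z > -8m. *)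
split=> [al dal pal|al r dal r0]; have [z [hz z0 zl zu]] := D0sharp_degree n_gt0 nm dal.
  apply: (reflect_loc_nilp dal hz _ (S_all _ 0%Z dal)).
  have [l hl] := poscomb_degree n_gt0 nm pal.
  have : z = l%:Z by apply: (@intr_inj C); rewrite -hz hl.
  by rewrite mul0r addr0; lia.
by apply: (reflect_loc_nilp dal hz _ (S_all _ r%:Z dal)); nia.
Qed.

End Integrability.

(** * Coordinates of the highest weight *)

Section TopWeight.
Variables (m n : nat) (ks : nat -> C).
Hypothesis nm : (n <= m)%N.

Definition top_weight : 'rV[C]_(m + n) :=
  \sum_(i < n) ks i *: beta m n i + \sum_(n <= i < m) ks i *: eps m n i.

Lemma top_weight_eps (i : 'I_m) : top_weight 0 (lshift n i) = ks i.
Proof.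
rewrite /top_weight mxE !summxE.
rewrite -(big_mkord xpredT (fun j => (ks j *: beta m n j) 0 (lshift n i))).
have -> : \sum_(0 <= j < n) (ks j *: beta m n j) 0 (lshift n i)
   = \sum_(0 <= j < n) (ks j *: eps m n j) 0 (lshift n i).
  apply: eq_bigr => j _.
  rewrite [LHS]mxE [RHS]mxE /beta [(_ - _ : 'M_(_, _)) _ _]mxE [(- _ : 'M_(_, _)) _ _]mxE.
  by rewrite delE0 subr0.
rewrite -(big_cat_nat (n := n)) //= (bigD1_seq (i : nat)) ?mem_index_iota ?iota_uniq //=.
rewrite big1 ?addr0 => [|j ji]; last by rewrite mxE epsE eq_sym (negbTE ji) mulr0.
by rewrite mxE epsE eqxx mulr1.
Qed.

Lemma top_weight_del (j : 'I_n) : top_weight 0 (rshift m j) = - ks j.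
Proof.
rewrite /top_weight mxE !summxE [X in _ + X]big1 ?addr0 => [|i _]; last first.
  by rewrite mxE epsE0 mulr0.
rewrite (bigD1 j) //= big1 ?addr0 => [|i ij].
  by rewrite [LHS]mxE /beta [(_ - _ : 'M_(_, _)) _ _]mxE [(- _ : 'M_(_, _)) _ _]mxE epsE0 delE eqxx sub0r mulrN1.
rewrite [LHS]mxE /beta [(_ - _ : 'M_(_, _)) _ _]mxE [(- _ : 'M_(_, _)) _ _]mxE epsE0 delE.
by rewrite eq_sym (negbTE (_ : i != j :> nat)) ?subr0 ?mulr0.
Qed.

Lemma top_weightP (mu : 'rV[C]_(m + n)) :
  (forall i, (i < n)%N -> hform mu (beta m n i) = 0) ->
  (forall i, (i < m)%N -> 2 * hform mu (eps m n i) = ks i) -> mu = top_weight.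
Proof.
move=> hb he.
have muE (i : 'I_m) : mu 0 (lshift n i) = ks i.
  by rewrite -he // hformC hform_eps; field.
apply/rowP => z; case: (split_ordP z) => i ->; first by rewrite muE top_weight_eps.
have im : (i < m)%N by apply: leq_trans (ltn_ord i) nm.
rewrite top_weight_del; have := hb i (ltn_ord i).
rewrite /beta hformBr hformC (hform_eps (Ordinal im)) hformC hform_del muE /=.
move/(congr1 (fun c => 2 * c)); rewrite mulr0 => h0.
by apply/eqP; rewrite -subr_eq0 opprK; apply/eqP; rewrite -[RHS]h0; field.
Qed.
End TopWeight.

Theorem theorem5p5 (m n : nat) (hn : (1 <= n)%N) (hnm : (n <= m)%N)
    (Lam : affwt m n) (hk : alev Lam != 0)
    (hbeta : forall i, (i < n)%N -> hform (afin Lam) (beta m n i) = 0)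
    (V : lmodType C) (act : int -> 'M[C]_(NN m n) -> V -> V) (actK actd : V -> V)
    (hL : is_L act actK actd Lam) :
  integrable act <->
  exists (c : C) (k : nat) (ks : nat -> nat),
    [/\ (0 < k)%N, (ks m.-1 <= k)%N,
        (forall i, (i.+1 < m)%N -> (ks i <= ks i.+1)%N) &
        Lam = AffWt (\sum_(i < n) (ks i)%:R *: beta m n i
                     + \sum_(n <= i < m) (ks i)%:R *: eps m n i) k%:R c].
Proof.
case: hL => hmod hirr [v hwv]; have [v0 [hH [hK [hd _]]]] := hwv.
have hlevel := level_scalar hmod hirr v0 hK.
pose om : affW m n := (afin Lam, adelta Lam).
have wv : wtvec act actd om v by split.
have hv := hw_highest hn hnm hwv.
have m_gt0 : (0 < m)%N := leq_trans hn hnm; have mm : (m.-1 < m)%N by lia.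
split=> [/(integrable_necessary hn hnm hmod hlevel wv v0 hv)[]|].
  move=> [j0 h0] hs [jk hk'].
  (* The hypotheses give one natural number for each difference; summing them up to index l produces
     a single function. *)
  have ex l : exists ks : nat -> nat, forall i, (i < m)%N -> (i <= l)%N ->
      2 * hform (afin Lam) (eps m n i) = (ks i)%:R.
    elim: l => [|l [ks IH]].
      by exists (fun=> j0) => i _; rewrite leqn0 => /eqP ->.
    have [lm|lm] := ltnP l.+1 m; last first.
      by exists ks => i im il; apply: IH => //; lia.
    have [j hj] := hs l lm.
    exists (fun i => if i == l.+1 then (ks l + j)%N else ks i) => i im il.
    case: eqP => [->|/eqP ne]; last by apply: IH => //; lia.
    by rewrite natrD -hj -IH ?(ltnW lm) // addrC subrK.
  have [ks ksE] := ex m; have ksE' i (im : (i < m)%N) := ksE i im (ltnW im).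
  have kE : alev Lam = (jk + ks m.-1)%:R by rewrite natrD -hk' -ksE' // subrK.
  exists (adelta Lam), (jk + ks m.-1)%N, ks; split.
  (* The level is now a natural number, so being nonzero makes it positive. *)
  - by rewrite lt0n; apply: contraNneq hk => k0; rewrite kE k0.
  - exact: leq_addl.
  - move=> i im; have [j] := hs i im; rewrite /= (ksE' _ im) (ksE' _ (ltnW im)).
    move/eqP; rewrite subr_eq -natrD eqr_nat => /eqP ->; exact: leq_addl.
  have := top_weightP hnm hbeta ksE'; rewrite /top_weight => <-.
  by rewrite -kE; case: (Lam).
move=> [c [k [ks [k_gt0 ksk mono LamE]]]].
have muE i : (i < m)%N -> 2 * hform (afin Lam) (eps m n i) = (ks i)%:R.
  move=> im; rewrite hformC (hform_eps (Ordinal im)) LamE.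
  by rewrite (top_weight_eps (fun j => (ks j)%:R) hnm (Ordinal im)) /=; field.
apply: (integrable_sufficient hn hnm hmod hirr hlevel wv v0 hv hbeta).
- by exists (ks 0%N); apply: muE.
- move=> b bm; exists (ks b.+1 - ks b)%N.
  by rewrite /= !muE ?(ltnW bm) // natrB // mono.
by exists (k - ks m.-1)%N; rewrite /= muE // natrB // LamE.
Qed.
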